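(* Let $F$ be a probability distribution on $[0,\infty)$ with finite mean and finite variance, having a density $f$. Let $-1<\alpha<0$ and assume that $\frac{f(t)}{t^{\alpha}}\to C$ as $t\to 0+$, where $C>0$ is a constant. Let $T_n^{NN}$ be the length of the nearest neighbor tour on $n$ cities in the mean field traveling salesman problem with intercity distance distribution $F$. Then the sequence of real numbers $\{\mathbb{E}[T_n^{NN}]\}_{n}$ is convergent, and $T_n^{NN}$ converges weakly (i.e. in distribution to some real random variable) as $n\to\infty$.
   Context: Mean field traveling salesman problem: there are $n$ cities $1,2,\dots,n$, and the intercity distances $L_{ij}=L_{ji}$, $1\le i<j\le n$, are i.i.d. random variables with distribution $F$ (no triangle inequality is required). Nearest neighbor (NN) tour: start at $v_1=1$; given $v_1,\dots,v_i$ with $i<n$, let $v_{i+1}$ be the city $u\notin\{v_1,\dots,v_i\}$ minimizing $L_{v_i u}$ (ties broken arbitrarily; they have probability zero when $F$ has a density); after all cities are visited, return to city $1$, i.e. $v_{n+1}=1$. The length of the NN tour is $T_n^{NN}=\sum_{i=1}^{n} L_{v_i v_{i+1}}$. *)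

(* Defs.v *)
From HB Require Import structures.
From mathcomp Require Import all_boot all_order all_algebra.
From mathcomp Require Import all_classical all_reals all_analysis.

Set Implicit Arguments.
Unset Strict Implicit.
Unset Printing Implicit Defensive.

Import Order.TTheory GRing.Theory Num.Theory.
Import numFieldNormedType.Exports.

Local Open Scope classical_set_scope.
Local Open Scope ring_scope.

Definition has_density (R : realType) (F : probability R R) (f : R -> R) :
    Prop :=
  [/\ forall t, 0 <= f t,
      measurable_fun [set: R] f
    & forall A : set R, measurable A ->
        F A = (\int[lebesgue_measure]_(t in A) (f t)%:E)%E].

(* For the preimages of all families of Borel sets, the product rule over every
   finite set of indices. *)
Definition mutually_independent (R : realType) (d : measure_display)
    (T : measurableType d) (P : probability T R) (I : finType)
    (X : I -> {RV P >-> R}) : Prop :=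
  forall (J : {set I}) (A : I -> set R), (forall i, measurable (A i)) ->
    P (\bigcap_(i in [set` J]) (X i @^-1` A i))
      = (\prod_(i in J) P (X i @^-1` A i))%E.

Definition iid (R : realType) (d : measure_display) (T : measurableType d)
    (P : probability T R) (I : finType) (X : I -> {RV P >-> R})
    (F : probability R R) : Prop :=
  mutually_independent X /\
  (forall i (A : set R), measurable A -> distribution P (X i) A = F A).

Definition edge (n : nat) : Type := {e : 'I_n * 'I_n | (e.1 < e.2)%N}.

(* Only the distances L i j with i < j are independent; symmetry determines the
   others.  The diagonal is unconstrained: no tour of at least two cities uses
   it. *)
Definition mean_field_distances (R : realType) (d : measure_display)
    (T : measurableType d) (P : probability T R) (n : nat)
    (L : 'I_n -> 'I_n -> {RV P >-> R}) (F : probability R R) : Prop :=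
  (forall i j w, L i j w = L j i w) /\
  iid (fun e : edge n => L (val e).1 (val e).2) F.

(* The cities of an (n+1)-city instance are the elements of 'I_n.+1, and
   v 0, ..., v n, v n.+1 are the successive stops, city 1 being ord0.  Any
   minimizer is allowed at each step, so every tie-breaking rule is covered. *)
Definition is_nn_tour (R : realType) (n : nat) (l : 'I_n.+1 -> 'I_n.+1 -> R)
    (v : nat -> 'I_n.+1) : Prop :=
  [/\ v 0%N = ord0,
      v n.+1 = ord0
    & forall i : nat, (i < n)%N ->
        let unvisited u := forall j : nat, (j <= i)%N -> u <> v j in
        unvisited (v i.+1) /\
        (forall u, unvisited u -> l (v i) (v i.+1) <= l (v i) u)].

Definition tour_length (R : realType) (n : nat) (l : 'I_n.+1 -> 'I_n.+1 -> R)
    (v : nat -> 'I_n.+1) : R :=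
  \sum_(i < n.+1) l (v i) (v i.+1).

(* The random variables of the sequence may live on different probability
   spaces. *)
Definition cvg_in_distribution (R : realType) (d : nat -> measure_display)
    (T : forall n, measurableType (d n)) (P : forall n, probability (T n) R)
    (X : forall n, {RV (P n) >-> R}) (d' : measure_display)
    (T' : measurableType d') (Q : probability T' R) (Z : {RV Q >-> R}) : Prop :=
  forall g : R -> R, continuous g -> bounded_fun g ->
    ('E_(P n)[g \o X n])%E @[n --> \oo] --> ('E_Q[g \o Z])%E.

(* Main.v *)
(* The greedy walk leaves each city along the shortest of its edges to the
   cities still unvisited, and these edges have not been looked at before.  Hence the
   greedy path through k further cities has the law of M_1 + ... + M_k, where M_j
   is the minimum of j copies of F and the summands are independent.  Writing G
   for the tail of F, the expectation of M_j is the integral of G ^ j, and the sum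
   over j is bounded by the integral of G / (1 - G), which is finite because
   alpha < 0 makes t ^ - (alpha + 1) integrable at 0.

   The tour is closed by an edge of the initial city that is almost independent of
   the path: its only bias is that it is not the shortest one.  This bias makes it
   stochastically larger than F, so with n + 2 cities the length T_n dominates the
   sum S_n + X of independent variables S_n = M_1 + ... + M_n and X with law F; on
   the other hand E T_n - E (S_n + X) tends to 0.  The laws of S_n + X increase
   stochastically and have bounded means.  Therefore their quantile functions
   increase to an integrable function Z on [0, 1], those of T_n converge to Z in
   L^1, and T_n converges in law to Z. *)
Require Import Defs.
From HB Require Import structures.
From mathcomp Require Import all_boot all_order all_algebra.
From mathcomp Require Import all_classical all_reals all_analysis.
From mathcomp Require Import measurable_realfun.
From mathcomp Require Import lra ring.

Set Implicit Arguments.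
Unset Strict Implicit.
Unset Printing Implicit Defensive.

Import Order.TTheory GRing.Theory Num.Theory.
Import numFieldNormedType.Exports.

Local Open Scope classical_set_scope.
Local Open Scope ring_scope.

(** * Sums and minima of independent random variables *)

(** Only the starting city has edges that matter twice: all of them compete in the first step, and
    one of them closes the tour. Once the first neighbour w is fixed, the rest of the path and its
    end y depend on edges among the other cities, hence are independent of the star of the starting
    city. The length of the first step and the closing edge lie in that same star, so their joint
    law is avoided: the lower bound drops the first step, and what it loses in mean is a single
    expected minimum, which tends to 0 because these expectations are summable. The exact law of the
    tour is therefore never computed; a stochastic lower bound and an asymptotically matching mean
    determine the limit. Since the instances may live on unrelated probability spaces, no pathwise
    comparison is available, and the quantile functions provide one common space on which domination
    becomes a pointwise inequality. *)

Section product_probability.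
Context d1 d2 (T1 : measurableType d1) (T2 : measurableType d2) (R : realType).
Variables (P1 : probability T1 R) (P2 : probability T2 R).

Definition prodp : set (T1 * T2) -> \bar R := (P1 \x P2)%E.

HB.instance Definition _ := Measure.on prodp.

Let prodp_setT : prodp [set: _] = 1%E.
Proof.
rewrite /prodp -setXTT product_measure1E//. by rewrite [X in (X *
  _)%E]probability_setT [X in (_ * X)%E]probability_setT mul1e.
Qed.

HB.instance Definition _ := Measure_isProbability.Build _ _ _ prodp prodp_setT.

Lemma prodpE A : measurable A -> prodp A = (\int[P1]_x P2 (xsection A x))%E.
Proof. by []. Qed.

Lemma prodpX A B : measurable A -> measurable B ->
  prodp (A `*` B) = (P1 A * P2 B)%E.
Proof. exact: product_measure1E. Qed.

End product_probability.

Section positive_tail.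
Context (R : realType).
Implicit Types (m : probability R R) (t : R).

Definition pospart (x : R) : R := Num.max x 0.

Lemma measurable_pospart : measurable_fun [set: R] pospart.
Proof. by apply: measurable_maxr => //; exact: measurable_cst. Qed.

HB.instance Definition _ :=
  isMeasurableFun.Build _ _ _ _ pospart measurable_pospart.

Lemma pospart_ge0 x : 0 <= pospart x.
Proof. by rewrite /pospart le_max lexx orbT. Qed.

Lemma pospart_id x : 0 <= x -> pospart x = x.
Proof. by rewrite /pospart => /max_l. Qed.

(* Laws are compared through the tails of their positive parts, so that the null
   set of negative values never has to be discarded. *)
Definition ptail m t : \bar R := m [set y | t < pospart y].

Lemma ptailE m t : ptail m t = ccdf (pospart : {RV m >-> R}) t.
Proof.
rewrite /ptail /ccdf /distribution /pushforward; congr (m _).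
by apply/seteqP; split => x /=; rewrite in_itv/= andbT.
Qed.

Lemma measurable_ptail_set t : measurable [set y : R | t < pospart y].
Proof.
have -> : [set y | t < pospart y] = pospart @^-1` `]t, +oo[.
  by apply/seteqP; split => x /=; rewrite in_itv/= andbT.
by rewrite -[X in measurable X]setTI; exact: measurable_pospart.
Qed.

Lemma ptail_nonincreasing m s t : s <= t -> (ptail m t <= ptail m s)%E.
Proof. by move=> st; rewrite !ptailE; exact: ccdf_nonincreasing. Qed.

Lemma measurable_ptail m : measurable_fun [set: R] (ptail m).
Proof.
rewrite (_ : ptail m = ccdf (pospart : {RV m >-> R})).
  exact: ccdf_measurable.
by apply/funext => t; rewrite ptailE.
Qed.

Lemma ptail_ge0 m t : (0 <= ptail m t)%E. Proof. exact: measure_ge0. Qed.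

Lemma ptail_le1 m t : (ptail m t <= 1)%E.
Proof. by apply: probability_le1; exact: measurable_ptail_set. Qed.

Lemma ptail_fin m t : ptail m t \is a fin_num.
Proof. by rewrite fin_num_measure//; exact: measurable_ptail_set. Qed.

Lemma ptail_lt0 m t : t < 0 -> ptail m t = 1%E.
Proof.
move=> t0; rewrite /ptail (_ : [set _ | _] = setT) ?probability_setT//.
by apply/seteqP; split => // x _ /=; apply: lt_le_trans (pospart_ge0 x).
Qed.

Definition pmean m : \bar R := (\int[m]_x (pospart x)%:E)%E.

Lemma pmean_ptail m :
  pmean m = (\int[lebesgue_measure]_(t in `[0%R, +oo[) ptail m t)%E.
Proof.
transitivity ('E_m[(pospart : {RV m >-> R})])%E; first by rewrite unlock.
rewrite ge0_expectation_ccdf//; last exact: pospart_ge0.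
by apply: eq_integral => t _; rewrite ptailE.
Qed.

Lemma pmean_ge0 m : (0 <= pmean m)%E.
Proof. by apply: integral_ge0 => x _; rewrite lee_fin pospart_ge0. Qed.

Definition minop (p : R * R) : R := Num.min p.1 p.2.

Lemma measurable_minop : measurable_fun [set: R * R] minop.
Proof. by apply: measurable_minr; [exact: measurable_fst|exact:
  measurable_snd]. Qed.

HB.instance Definition _ := isMeasurableFun.Build _ _ _ _ minop
  measurable_minop.

(** Unlike the minimum, addition does not commute with [pospart]. Truncating first makes the law of
    the sum depend on its two summands only through their [ptail]. *)
Definition addop (p : R * R) : R := pospart p.1 + pospart p.2.

Lemma measurable_addop : measurable_fun [set: R * R] addop.
Proof.
by apply: measurable_funD; apply: measurableT_comp;
  [exact: measurable_pospart|exact: measurable_fst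
  |exact: measurable_pospart|exact: measurable_snd].
Qed.

HB.instance Definition _ := isMeasurableFun.Build _ _ _ _ addop
  measurable_addop.

Definition minp (m1 m2 : probability R R) : probability R R :=
  distribution (prodp m1 m2) minop.

Definition addp (m1 m2 : probability R R) : probability R R :=
  distribution (prodp m1 m2) addop.

Lemma ptail_minp m1 m2 t : ptail (minp m1 m2) t = (ptail m1 t * ptail m2 t)%E.
Proof.
rewrite /ptail -prodpX; [|exact: measurable_ptail_set|exact:
  measurable_ptail_set].
rewrite /minp/= /distribution/pushforward; congr (prodp _ _ _).
by apply/seteqP; split => -[x y]; rewrite /= /minop /pospart /= !lt_max lt_min;
  case: (t < x); case: (t < y); case: (t < 0) => //= -[].
Qed.

Lemma ptail_addp m1 m2 t :
  ptail (addp m1 m2) t = (\int[m1]_x ptail m2 (t - pospart x))%E.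
Proof.
rewrite {1}/ptail /addp/= /distribution/pushforward prodpE; last first.
  rewrite -[X in measurable X]setTI; apply: measurable_addop => //.
  exact: measurable_ptail_set.
apply: eq_integral => x _; congr (m2 _).
rewrite /xsection; apply/seteqP; split => y /=; rewrite inE /= /addop /=;
  rewrite [pospart (_ + _)]pospart_id ?ltrBlDl// addr_ge0 ?pospart_ge0//.
Qed.

Lemma pmean_addp m1 m2 : pmean (addp m1 m2) = (pmean m1 + pmean m2)%E.
Proof.
have mp (m : probability R R) :
    measurable_fun [set: R] (fun x : R => (pospart x)%:E).
  by apply/measurable_EFinP; exact: measurable_pospart.
rewrite {1}/pmean /addp ge0_integral_distribution//=; last 2 first.
- exact: (mp m1).
- by move=> y; rewrite lee_fin pospart_ge0.
rewrite (eq_integral (fun p : R * R => (pospart p.1)%:E + (pospart p.2)%:E)%E);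
  last first.
  by move=> p _; rewrite /= /addop [pospart (_ + _)]pospart_id ?addr_ge0
    ?pospart_ge0//.
rewrite ge0_integralD//; last 4 first.
- by move=> x _; rewrite lee_fin pospart_ge0.
- by apply/measurable_EFinP; apply: measurableT_comp => //;
  exact: measurable_pospart.
- by move=> x _; rewrite lee_fin pospart_ge0.
- by apply/measurable_EFinP; apply: measurableT_comp => //;
  exact: measurable_pospart.
rewrite /prodp fubini_tonelli1//=; last 2 first.
- by apply/measurable_EFinP; apply: measurableT_comp => //;
  exact: measurable_pospart.
- by move=> x; rewrite lee_fin pospart_ge0.
rewrite fubini_tonelli1//=; last 2 first.
- by apply/measurable_EFinP; apply: measurableT_comp => //;
  exact: measurable_pospart.
- by move=> x; rewrite lee_fin pospart_ge0.
rewrite /fubini_F /=; congr (_ + _)%E.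
  by apply: eq_integral => x _; rewrite integral_cst//= probability_setT mule1.
by rewrite integral_cst//= probability_setT mule1.
Qed.

(** Conditioning on the second summand is the form from which monotonicity in the first one can be
    read off. The two iterated integrals agree by uniqueness of the product measure. *)
Lemma ptail_addp_swap m1 m2 t :
  ptail (addp m1 m2) t = (\int[m2]_y ptail m1 (t - pospart y))%E.
Proof.
pose A := [set p : R * R | t < pospart (addop p)].
have mA : measurable A.
  rewrite -[X in measurable X]setTI.
  exact: (measurable_addop measurableT (measurable_ptail_set t)).
transitivity ((m1 \x m2)%E A); first by [].
rewrite (_ : (m1 \x m2)%E A = (m1 \x^ m2)%E A); last first.
  apply: product_measure_unique => // B C mB mC.
  by rewrite /= product_measure2E.
rewrite /= /product_measure2; apply: eq_integral => y _ /=; congr (m1 _).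
rewrite /ysection /A; apply/seteqP; split => x /=; rewrite inE /= /addop /=;
  rewrite [pospart (_ + _)]pospart_id ?ltrBlDr// addr_ge0 ?pospart_ge0//.
Qed.

Lemma measurable_ptailB m t : measurable_fun [set: R] (fun x : R => ptail m (t
  - pospart x)).
Proof.
apply: (measurableT_comp (measurable_ptail m)).
by apply: measurable_funB; [exact: measurable_cst|exact: measurable_pospart].
Qed.

Lemma ptail_addp_ge m1 m2 t : (ptail m1 t <= ptail (addp m1 m2) t)%E.
Proof.
rewrite ptail_addp_swap -[leLHS]mule1 -(probability_setT m2) -integral_cst//.
apply: ge0_le_integral => //; first exact: (measurable_ptailB m1 t).
by move=> x _; apply: ptail_nonincreasing; rewrite gerBl pospart_ge0.
Qed.

Lemma le_ptail_addp m m1 m2 t : (forall s, ptail m1 s <= ptail m2 s)%E ->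
  (ptail (addp m1 m) t <= ptail (addp m2 m) t)%E.
Proof.
move=> m12; rewrite !ptail_addp_swap.
by apply: ge0_le_integral => //; exact: (measurable_ptailB _ t).
Qed.

End positive_tail.

Section nearest_neighbour_laws.
Context (R : realType) (F : probability R R).

(** The index is shifted: [minlaw k] is the minimum of k + 1 copies of [F]. Hence [pathlaw k] sums
    the minima of 1, ..., k copies, and its recursion adds the first step of the walk, the one with
    the most candidates. *)
Fixpoint minlaw k : probability R R :=
  if k is k'.+1 then minp F (minlaw k') else F.

Fixpoint pathlaw k : probability R R :=
  if k is k'.+1 then addp (pathlaw k') (minlaw k') else dirac (0 : R).

Definition tourlaw k : probability R R := addp (pathlaw k) F.

Lemma ptail_minlaw k t : ptail (minlaw k) t = (ptail F t ^+ k.+1)%E.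
Proof.
by elim: k => [|k IH]; rewrite ?expe1// [LHS]ptail_minp IH [RHS]expeS.
Qed.

Lemma ptail_tourlaw_nd k t : (ptail (tourlaw k) t <= ptail (tourlaw k.+1) t)%E.
Proof. by apply: le_ptail_addp => s; exact: ptail_addp_ge. Qed.

End nearest_neighbour_laws.

(** * Summability of the expected minima *)

Section power_singularity.
Context (R : realType).

Lemma powR_nonincreasing (a x y : R) : a <= 0 -> 0 < x -> x <= y ->
  y `^ a <= x `^ a.
Proof.
move=> a0 x0 xy; have y0 : 0 < y by exact: lt_le_trans xy.
have : x `^ (- a) <= y `^ (- a).
  by apply: ge0_ler_powR; rewrite ?nnegrE ?oppr_ge0// ltW.
by rewrite !powRN lef_pV2// posrE powR_gt0.
Qed.

(** For b < 1 the integrand blows up at 0, so the fundamental theorem is applied on intervals that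
    avoid 0 and the bound passes to their union by monotone convergence. *)
Lemma integral_powR_le (b r : R) : 0 < b -> 0 < r ->
  (\int[lebesgue_measure]_(x in `]0%R, r]) (b * x `^ (b - 1))%:E
     <= (r `^ b)%:E)%E.
Proof.
move=> b0 r0.
(* Dividing by n + 2 keeps the interval nondegenerate already for n = 0. *)
pose S (n : nat) : set R := `[r / n.+2%:R, r]%classic.
have rn n : 0 < r / n.+2%:R < r.
  by rewrite divr_gt0//= ltr_pdivrMr// ltr_pMr// ltr1n.
have US : `]0, r]%classic = \bigcup_n S n.
  apply/seteqP; split=> x /=.
    rewrite in_itv/= => /andP[x0 xr].
    exists (Num.truncn (r / x)) => //; rewrite /S /= in_itv/= xr andbT.
    rewrite ler_pdivrMr// mulrC -ler_pdivrMr//.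
    have /andP[_ h] := truncn_itv (divr_ge0 (ltW r0) (ltW x0)).
    by rewrite (le_trans (ltW h))// ler_nat.
  case=> n _; rewrite /S /= !in_itv/= => /andP[h ->]; rewrite andbT.
  by apply: lt_le_trans h; case/andP: (rn n).
have mf : measurable_fun [set: R] (fun x => (b * x `^ (b - 1))%:E).
  by apply/measurable_EFinP; apply: measurable_funM.
have cv : (\int[lebesgue_measure]_(x in S n) (b * x `^ (b - 1))%:E)%E @[n -->
  \oo]
    --> (\int[lebesgue_measure]_(x in \bigcup_n S n) (b * x `^ (b - 1))%:E)%E.
  apply: ge0_nondecreasing_set_cvg_integral.
  - move=> n m nm; apply/subsetPset => x; rewrite /S /= !in_itv/=.
    move=> /andP[h ->]; rewrite andbT (le_trans _ h)//.
    by rewrite ler_pM2l// lef_pV2 ?posrE// ler_nat.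
  - by move=> n; exact: measurable_itv.
  - by move=> n; exact: measurable_funTS.
  - by move=> n x _; rewrite lee_fin mulr_ge0 ?powR_ge0// ltW.
rewrite US; apply: (cvge_le _ cv).
near=> n.
have /andP[a0 ar] := rn n.
rewrite /S (@continuous_FTC2 _ _ (fun x => x `^ b))//.
- by rewrite -EFinB lee_fin gerBl powR_ge0.
- apply: continuous_in_subspaceT => x; rewrite inE /= in_itv/= => /andP[ax _].
  apply: differentiable_continuous; apply/derivable1_diffP.
  apply: derivableM; first exact: derivable_cst.
  by apply: derivable_powR; rewrite in_itv/= andbT (lt_le_trans a0).
- have cb x : 0 < x -> {for x, continuous (fun x : R => x `^ b)}.
    move=> x0; apply: differentiable_continuous; apply/derivable1_diffP.
    by apply: derivable_powR; rewrite in_itv/= andbT.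
  split.
  + move=> x; rewrite in_itv/= => /andP[ax _].
    by apply: derivable_powR; rewrite in_itv/= andbT (lt_trans a0).
  + by apply: cvg_at_right_filter; exact: cb.
  + by apply: cvg_at_left_filter; exact: cb.
- move=> x; rewrite in_itv/= => /andP[ax _].
  by rewrite powR_derive1// in_itv/= andbT (lt_trans a0).
Unshelve. all: end_near. Qed.

End power_singularity.

Section pathlaw_mean.
Context (R : realType) (F : probability R R) (f : R -> R) (alpha C : R).
Hypothesis F_mean : F.-integrable [set: R] (fun t : R => t%:E).
Hypothesis F_density : has_density F f.
Hypothesis alpha_lt0 : alpha < 0.
Hypothesis C_gt0 : 0 < C.
Hypothesis f_near0 : f t / t `^ alpha @[t --> 0^'+] --> C.

Lemma density_atomless x : F [set x] = 0%E.
Proof.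
case: F_density => _ _ ->; last exact: measurable_set1.
by rewrite integral_set1.
Qed.

Lemma pmean_lty : (pmean F < +oo)%E.
Proof.
case/integrableP: F_mean => mi; apply: le_lt_trans;
  apply: ge0_le_integral => //.
- by move=> x _; rewrite lee_fin pospart_ge0.
- by apply/measurable_EFinP; exact: measurable_pospart.
- by apply: measurableT_comp.
- by move=> x _ /=; rewrite lee_fin /pospart ge_max ler_norm normr_ge0.
Qed.

(** Near 0 the density exceeds C / 2 times s ^ alpha. As alpha < 0, this power is smallest at the
    right end of ]0, t], so the mass of that interval is at least t times C / 2 times t ^ alpha, and
    no power has to be integrated. *)
Lemma ptail_near0 : exists c r : R, [/\ 0 < c, 0 < r &
  forall t, 0 < t <= r -> ((c * t `^ (alpha + 1))%:E <= 1 - ptail F t)%E].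
Proof.
have C20 : C / 2 < C by rewrite ltr_pdivrMr// ltr_pMr// ltr1n.
have : \forall t \near 0^'+, C / 2 < f t / t `^ alpha by apply: cvgr_gt f_near0
  _ _.
move=> [e /= e0 He]; exists (C / 2), (e / 2); split; rewrite ?divr_gt0//.
move=> t /andP[t0 te].
have fC s : 0 < s <= t -> C / 2 * t `^ alpha <= f s.
  move=> /andP[s0 st].
  have : C / 2 < f s / s `^ alpha.
    by apply: He => //=; rewrite sub0r normrN gtr0_norm//;
      apply: (le_lt_trans st); apply: (le_lt_trans te);
        rewrite ltr_pdivrMr// ltr_pMr// ltr1n.
  rewrite ltr_pdivlMr ?powR_gt0// => /ltW; apply: le_trans.
  by rewrite ler_pM2l ?divr_gt0// powR_nonincreasing// ltW.
have -> : (1 - ptail F t)%E = F [set y | pospart y <= t].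
  rewrite /ptail -probability_setC; last exact: measurable_ptail_set.
  by congr (F _); apply/seteqP; split => x /=; rewrite leNgt => /negP.
apply: (@le_trans _ _ (F `]0, t]%classic)); last first.
  apply: le_measure; rewrite ?inE//.
    have -> : [set y | pospart y <= t] = ~` [set y | t < pospart y].
      by apply/seteqP; split => x /=; rewrite leNgt => /negP.
    by apply: measurableC; exact: measurable_ptail_set.
  by move=> x /=; rewrite in_itv/= => /andP[x0 xt]; rewrite pospart_id// ltW.
case: F_density => f0 mf ->//.
apply: (@le_trans _ _ (\int[lebesgue_measure]_(s in `]0%R, t]) (C / 2 * t `^
  alpha)%:E)%E).
  rewrite integral_cst//= lebesgue_measure_itv/= lte_fin t0 sube0 -EFinM
    lee_fin.
  by rewrite powRD ?(gt_eqF t0)/= ?implybT// powRr1 ?(ltW t0)// mulrA lexx.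
apply: ge0_le_integral => //.
- by move=> x _; rewrite lee_fin mulr_ge0 ?powR_ge0// ltW// divr_gt0.
- by apply/measurable_EFinP; exact: measurable_funTS.
Qed.

Lemma measurable_ptailX j :
  measurable_fun [set: R] (fun t => ptail F t ^+ j.+1)%E.
Proof.
apply: (eq_measurable_fun (ptail (minlaw F j))); last exact: measurable_ptail.
by move=> t _; rewrite ptail_minlaw.
Qed.

(* Summing the geometric series under the integral sign, the mean of the limit
   is at most the integral of G / (1 - G), G the tail of F.  This is where
   alpha < 0 matters: 1 - G is at least of order t ^ (alpha + 1) near 0. *)
Lemma pmean_pathlawE k : pmean (pathlaw F k) =
  (\int[lebesgue_measure]_(t in `[0%R, +oo[) \sum_(j < k) ptail F t ^+ j.+1)%E.
Proof.
rewrite ge0_integral_sum//; last 2 first.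
- by move=> j; apply: measurable_funTS; exact: measurable_ptailX.
- by move=> j x _; rewrite expe_ge0// ptail_ge0.
elim: k => [|k IH].
  rewrite big_ord0 /pmean/= integral_dirac//=.
    by rewrite /pospart maxxx mule0.
  by apply/measurable_EFinP; exact: measurable_pospart.
rewrite big_ord_recr/= -IH pmean_addp; congr (_ + _)%E.
by rewrite pmean_ptail; apply: eq_integral => t _; rewrite ptail_minlaw.
Qed.

Lemma sum_geometric_le (x : R) k : 0 <= x -> x < 1 ->
  \sum_(j < k) x ^+ j.+1 <= x / (1 - x).
Proof.
move=> x0 x1; have x10 : 0 < 1 - x by rewrite subr_gt0.
rewrite ler_pdivlMr//.
have -> : \sum_(j < k) x ^+ j.+1 = x * \sum_(j < k) x ^+ j.
  by rewrite big_distrr/=; apply: eq_bigr => j _; rewrite exprS.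
have := subrX1 x k => h.
rewrite -mulrA (mulrC _ (1 - x)) -opprB mulNr -h opprB.
by rewrite ler_piMr// gerBl exprn_ge0.
Qed.

(** The range is cut at r. Below r, G / (1 - G) is at most 1 / (c t ^ (alpha + 1)), integrable since
    - alpha > 0. Beyond r, 1 - G stays above its lower bound at r, so what remains is a multiple of
    the integral of G, that is, of the mean of [F]. *)
Lemma pathlaw_mean_bounded : exists M : R,
  forall k, (pmean (pathlaw F k) <= M%:E)%E.
Proof.
have [c [r [c0 r0 H]]] := ptail_near0.
have b0 : 0 < - alpha by rewrite oppr_gt0.
pose G t := fine (ptail F t).
have GE t : ptail F t = (G t)%:E by rewrite fineK// ptail_fin.
have G0 t : 0 <= G t by rewrite fine_ge0// ptail_ge0.
have sumE k t : (\sum_(j < k) ptail F t ^+ j.+1 = (\sum_(j < k) G t ^+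
  j.+1)%:E)%E.
  by rewrite -sumEFin; apply: eq_bigr => j _; rewrite GE EFin_expe.
have sum_le k t : G t < 1 -> \sum_(j < k) G t ^+ j.+1 <= G t / (1 - G t).
  exact: sum_geometric_le.
have GH t : 0 < t <= r -> c * t `^ (alpha + 1) <= 1 - G t.
  by move=> /H; rewrite GE -EFinB lee_fin.
(* The division by - alpha turns the bound near 0 into [K1] times b t ^ (b - 1) with b = - alpha,
   the integrand of [integral_powR_le]. *)
pose K1 := c^-1 / - alpha.
pose K2 := (c * r `^ (alpha + 1))^-1.
have crp t : 0 < t -> 0 < c * t `^ (alpha + 1) by move=> t0;
  rewrite mulr_gt0// powR_gt0.
exists (K1 * r `^ (- alpha) + K2 * fine (pmean F)) => k.
have msum (D : set R) : measurable_fun D (fun t => \sum_(j < k) ptail F t ^+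
  j.+1)%E.
  apply: measurable_funTS; apply: emeasurable_sum => j.
  by exact: measurable_ptailX.
rewrite pmean_pathlawE -integral_itv_obnd_cbnd//.
have -> : `]0, +oo[%classic = `]0, r]%classic `|` `]r, +oo[%classic :> set R.
  by rewrite -itv_bndbnd_setU// bnd_simp// ltW.
rewrite ge0_integral_setU//; last 3 first.
- exact: msum.
- by move=> t _; rewrite sumE lee_fin sumr_ge0// => j _; rewrite exprn_ge0.
- apply/disj_setPRL => t /=; rewrite !in_itv/= andbT => rt.
  by apply/negP; rewrite negb_and -!ltNge rt orbT.
rewrite EFinD leeD//.
- apply: (@le_trans _ _ (\int[lebesgue_measure]_(t in `]0%R, r]) (K1%:E * (-
  alpha * t `^ (- alpha - 1))%:E))%E).
    apply: ge0_le_integral => //.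
    + by move=> t _; rewrite sumE lee_fin sumr_ge0// => j _; rewrite exprn_ge0.
    + exact: msum.
    + apply: measurable_funTS; apply: measurable_funeM.
      by apply/measurable_EFinP; apply: measurable_funM.
    + move=> t /=; rewrite in_itv/= => tr; have t0 : 0 < t by case/andP: tr.
      have h := GH _ tr; have h' := crp _ t0.
      have G1 : G t < 1 by lra.
      rewrite sumE -EFinM lee_fin (le_trans (sum_le k t G1))//.
      rewrite ler_pdivrMr ?subr_gt0//.
      have -> : K1 * (- alpha * t `^ (- alpha - 1)) = (c * t `^ (alpha + 1))^-1.
        rewrite /K1 mulrA divfK ?gt_eqF// invfM -powRN opprD//.
      by rewrite mulrC ler_pdivlMr// (le_trans _ h)// ler_piMl// ?ltW.
  rewrite ge0_integralZl//; last 3 first.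
  + by apply: measurable_funTS; apply/measurable_EFinP; apply: measurable_funM.
  + by move=> t _; rewrite lee_fin mulr_ge0 ?powR_ge0// ltW.
  + by rewrite lee_fin /K1 divr_ge0 ?invr_ge0// ltW.
  have K10 : (0 <= K1%:E)%E by rewrite lee_fin /K1 divr_ge0 ?invr_ge0// ltW.
  exact: (lee_wpmul2l K10 (integral_powR_le b0 r0)).
- have K20 : 0 <= K2 by rewrite /K2 invr_ge0 ltW// crp.
  apply: (@le_trans _ _ (\int[lebesgue_measure]_(t in `]r, +oo[) (K2%:E * ptail
    F t))%E).
    apply: ge0_le_integral => //.
    + by move=> t _; rewrite sumE lee_fin sumr_ge0// => j _; rewrite exprn_ge0.
    + exact: msum.
    + apply: measurable_funTS; apply: measurable_funeM.
      exact: measurable_ptail.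
    + move=> t /=; rewrite in_itv/= andbT => rt.
      have Gtr : G t <= G r by rewrite -lee_fin -!GE ptail_nonincreasing// ltW.
      have h := GH r; rewrite r0 lexx in h; have {}h := h isT;
        have h' := crp _ r0.
      have G1 : G t < 1 by lra.
      rewrite sumE GE -EFinM lee_fin (le_trans (sum_le k t G1))//.
      rewrite mulrC ler_wpM2r// /K2 lef_pV2 ?posrE ?subr_gt0//; lra.
  rewrite ge0_integralZl//; last by apply: measurable_funTS;
    exact: measurable_ptail.
  rewrite EFinM fineK; last by rewrite ge0_fin_numE ?pmean_ge0 ?pmean_lty.
  apply: lee_pmul; rewrite ?lee_fin//.
    by apply: integral_ge0 => t _; exact: ptail_ge0.
  rewrite pmean_ptail; apply: ge0_subset_integral => //.
  + by apply: measurable_funTS; exact: measurable_ptail.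
  + by move=> t /=; rewrite !in_itv/= !andbT => /ltW; apply: le_trans;
    rewrite ltW.
Qed.


End pathlaw_mean.

(** * Quantiles and weak limits under stochastic domination *)

Section quantile.
Context (R : realType).
Implicit Types (H : R -> R) (m : probability R R).

(** Nonincreasing, right-continuous and vanishing at infinity. In this order-theoretic form the
    clauses pass to the supremum of a sequence of tails, the last one under a bound on the means. *)
Definition tail_fun H := [/\ forall x y, x <= y -> H y <= H x,
  forall v x, v < H x -> exists2 y, x < y & v < H y &
  forall v, 0 < v -> exists2 y, 0 <= y & H y <= v].

(* The levels v outside ]0, 1[ have probability 0 under the uniform law on
   [0, 1]; for the others, sup set0 = 0 is the intended value. *)
Definition quantile H (v : R) : R :=
  if 0 < v then sup [set x | 0 <= x /\ v < H x] else 0.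

(** That both inequalities are strict rests on right continuity: from v < H x it yields some y > x
    that still belongs to the set whose supremum is the quantile. *)
Lemma lt_quantile H v x : tail_fun H -> 0 < v -> 0 <= x ->
  (x < quantile H v) = (v < H x).
Proof.
case=> Hn Hr H0 v0 x0; rewrite /quantile v0.
set A := [set _ | _].
have ubA : has_ubound A.
  have [y y0 Hy] := H0 _ v0; exists y => z [z0 vz].
  rewrite leNgt; apply/negP => /ltW /Hn Hz.
  by have := lt_le_trans vz (le_trans Hz Hy); rewrite ltxx.
apply/idP/idP => [xs|vx].
  have [[a Aa]|A0] := pselect (A !=set0).
    have [a' [a'0 va']] : exists2 a', A a' & x < a'.
      by apply: sup_gt => //; exists a.
    by move=> xa'; apply: lt_le_trans va' (Hn _ _ (ltW xa')).
  have A00 : A = set0 by apply/seteqP; split => // z Az; apply: A0; exists z.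
  by move: xs; rewrite A00 sup0 ltNge x0.
have [y xy vy] := Hr _ _ vx.
by apply: (lt_le_trans xy); apply: ub_le_sup => //; split => //;
  apply: le_trans (ltW xy).
Qed.

Lemma quantile_ge0 H v : tail_fun H -> 0 <= quantile H v.
Proof.
move=> tH; have [v0|v0] := ltP 0 v; last first.
  by rewrite /quantile (ltNge 0 v) v0.
rewrite leNgt; apply/negP => q0.
rewrite /quantile v0 in q0.
have [[a [a0 va]]|A0] := pselect ([set x | 0 <= x /\ v < H x] !=set0).
  have : a < quantile H v by rewrite lt_quantile.
  by rewrite /quantile v0 ltNge (le_trans (ltW q0)).
by move: q0; rewrite (_ : [set _ | _] = set0) ?sup0 ?ltxx//;
  apply/seteqP; split => // z Az; apply: A0; exists z.
Qed.

Lemma le_quantile H K v : tail_fun H -> tail_fun K ->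
  (forall x, H x <= K x) -> quantile H v <= quantile K v.
Proof.
move=> tH tK HK; have [v0|v0] := ltP 0 v; last first.
  by rewrite /quantile (ltNge 0 v) v0.
rewrite leNgt; apply/negP; rewrite lt_quantile// ?quantile_ge0// => vH.
have := lt_le_trans vH (HK _).
by rewrite -lt_quantile ?quantile_ge0// ltxx.
Qed.

Lemma preimage_quantile H x : tail_fun H -> 0 <= x ->
  [set v | x < quantile H v] = `]0, H x[%classic.
Proof.
move=> tH x0; apply/seteqP; split => v /=; rewrite in_itv/=.
  have [v0|v0] := ltP 0 v; first by rewrite lt_quantile.
  by rewrite /quantile (ltNge 0 v) v0/= ltNge x0.
by case/andP => v0 vH; rewrite lt_quantile.
Qed.

Lemma measurable_quantile H : tail_fun H ->
  @measurable_fun _ _ (measurableTypeR R) R setT (quantile H).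
Proof.
move=> tH; apply: (measurability _ (RGenOInfty.measurableE R)) => //.
move=> _ [_ [x ->] <-]; rewrite setTI.
rewrite (_ : _ @^-1` _ = [set v | x < quantile H v]); last first.
  by apply/seteqP; split => v /=; rewrite in_itv/= andbT.
have [x0|x0] := leP 0 x; first by rewrite preimage_quantile.
rewrite (_ : [set _ | _] = setT)//; apply/seteqP; split => // v _ /=.
exact: lt_le_trans (quantile_ge0 _ tH).
Qed.

Lemma tail_fun_ptail m : tail_fun (fine \o ptail m).
Proof.
split=> [x y xy|v x vx|v v0] /=.
- by rewrite fine_le ?ptail_fin// ptail_nonincreasing.
- have cv : (fine \o ptail m) y @[y --> x^'+] --> fine (ptail m x).
    apply: fine_cvg; rewrite fineK ?ptail_fin// ptailE.
    rewrite (_ : ptail m = ccdf (@pospart R : {RV m >-> R})).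
      exact: ccdf_right_continuous.
    by apply/funext => t; rewrite ptailE.
  have := cvgr_gt _ cv _ vx; move=> [e /= e0 He].
  exists (x + e / 2); first by rewrite ltrDl divr_gt0.
  apply: He; last by rewrite ltrDl divr_gt0.
  by rewrite /= opprD addrA subrr sub0r normrN gtr0_norm ?divr_gt0//
    ltr_pdivrMr// ltr_pMr// ltr1n.
- have cv : (fine \o ptail m) y @[y --> +oo] --> (0 : R).
    apply: fine_cvg.
    rewrite (_ : ptail m = ccdf (@pospart R : {RV m >-> R})).
      exact: cvg_ccdfy0.
    by apply/funext => t; rewrite ptailE.
  have := cvgr_lt _ cv _ v0; move=> [A [Ar HA]].
  exists (Num.max 0 (A + 1)); first by rewrite le_max lexx.
  by apply/ltW/HA; rewrite lt_max ltrDl ltr01 orbT.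
Qed.

Definition unif01 : probability (measurableTypeR R) R := uniform_prob (@ltr01
  R).

Lemma unif01_itv (p : R) : 0 <= p <= 1 -> unif01 `]0, p[%classic = p%:E.
Proof.
move=> /andP[p0 p1]; have mA : measurable (`]0, p[%classic : set R) by [].
rewrite -[LHS]/((uniform_prob _) _) -[X in uniform_prob _ X]setIT
  -integral_indic//.
rewrite integral_uniform//; last by apply/measurable_EFinP;
  exact: measurable_indic.
rewrite subr0 invr1 mul1e integral_indic// setIidl; last first.
  by move=> x /=; rewrite !in_itv/= => /andP[x0 xp];
    rewrite (ltW x0) (le_trans (ltW xp)).
rewrite -[LHS]/(lebesgue_measure (`]0, p[%classic : set R))
  lebesgue_measure_itv/= lte_fin.
by case: ltgtP p0 => // [_ _|<- _]; rewrite ?sube0.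
Qed.

Lemma eq_distribution_tail d1 d2 (T1 : measurableType d1) (T2 : measurableType
  d2)
    (P1 : probability T1 R) (P2 : probability T2 R)
    (X1 : {RV P1 >-> R}) (X2 : {RV P2 >-> R}) :
  (forall x, ccdf X1 x = ccdf X2 x) ->
  forall A, measurable A -> distribution P1 X1 A = distribution P2 X2 A.
Proof.
move=> X12 A mA.
apply: (@measure_unique _ _ _ (@RGenOInfty.G R) (fun n => `]- n%:R,
  +oo[%classic)) => //.
- exact: RGenOInfty.measurableE.
- move=> _ _ [x ->] [y ->]; exists (Num.max x y).
  by apply/seteqP; split => z /=; rewrite !in_itv/= !andbT gt_max;
    [case=> -> ->|case/andP].
- by move=> n; exists (- n%:R).
- apply/seteqP; split => // x _; exists (Num.truncn `|x|).+1 => //=.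
  rewrite in_itv/= andbT ltrNl (le_lt_trans (ler_norm _))// normrN.
  by have /andP[] := truncn_itv (normr_ge0 x).
- by move=> _ [x ->]; exact: X12.
- by move=> n; rewrite (le_lt_trans (probability_le1 _ _)) ?ltry.
Qed.

(** Inverse transform sampling: by [preimage_quantile], the event x < q is an interval whose uniform
    measure is the tail at x. *)
Lemma distribution_quantile m (q : {RV unif01 >-> R}) A :
  q = quantile (fine \o ptail m) :> (R -> R) -> measurable A ->
  distribution unif01 q A = distribution m (@pospart R : {RV m >-> R}) A.
Proof.
move=> qE; have tm := tail_fun_ptail m.
apply: eq_distribution_tail => x.
rewrite -ptailE /ccdf/=/distribution/pushforward/= qE.
rewrite (_ : _ @^-1` _ = [set v | x < quantile (fine \o ptail m) v]);
  last first.
  by apply/seteqP; split => v /=; rewrite in_itv/= andbT.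
have [x0|x0] := leP 0 x.
  rewrite preimage_quantile// unif01_itv/= ?fineK ?ptail_fin//.
  rewrite fine_ge0 ?ptail_ge0//=.
  by rewrite -lee_fin fineK ?ptail_fin// ptail_le1.
rewrite ptail_lt0// (_ : [set _ | _] = setT) ?probability_setT//.
by apply/seteqP; split => // v _ /=; exact: lt_le_trans (quantile_ge0 _ tm).
Qed.

Definition quantile_rv H (tH : tail_fun H) : {RV unif01 >-> R} :=
  @mfun_Sub _ _ (measurableTypeR R) R _ (mem_set (measurable_quantile tH)).

Lemma integral_quantile_pos m :
  (\int[unif01]_v (quantile (fine \o ptail m) v)%:E = pmean m)%E.
Proof.
have tm := tail_fun_ptail m; pose q := quantile_rv tm.
have mp : measurable_fun [set: R] (fun x : R => (pospart x)%:E).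
  by apply/measurable_EFinP; exact: measurable_pospart.
transitivity (\int[distribution unif01 q]_x (pospart x)%:E)%E.
  rewrite ge0_integral_distribution//; last by move=> x;
    rewrite lee_fin pospart_ge0.
  by apply: eq_integral => v _ /=; rewrite pospart_id// quantile_ge0.
transitivity (\int[distribution m (@pospart R : {RV m >-> R})]_x (pospart
  x)%:E)%E.
  by apply: eq_measure_integral => A mA _; exact: distribution_quantile.
rewrite ge0_integral_distribution//; last by move=> x;
  rewrite lee_fin pospart_ge0.
by apply: eq_integral => v _ /=; rewrite pospart_id// pospart_ge0.
Qed.

Lemma integral_quantile_bounded m (g : R -> R) b : measurable_fun [set: R] g ->
  (forall x, `|g x| <= b) ->
  (\int[unif01]_v (g (quantile (fine \o ptail m) v))%:E =
   \int[m]_x (g (pospart x))%:E)%E.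
Proof.
move=> mg gb; have tm := tail_fun_ptail m; pose q := quantile_rv tm.
have b0 : 0 <= b by exact: le_trans (gb 0).
have ib d (T : measurableType d) (P : probability T R) (X : {RV P >-> R}) :
    P.-integrable setT (EFin \o g \o X).
  apply: (@le_integrable _ _ _ _ _ _ _ (fun=> b%:E)) => //.
  - by apply/measurable_EFinP; apply: measurableT_comp.
  - by move=> w _ /=; rewrite lee_fin (le_trans (gb _))// ler_norm.
  - apply/integrableP; split; first exact: measurable_cst.
    by rewrite integral_cst//= probability_setT mule1 ltry.
have mEg : measurable_fun [set: R] (EFin \o g) by exact/measurable_EFinP.
transitivity (\int[distribution unif01 q]_x (g x)%:E)%E.
  by rewrite (integral_distribution mEg (ib _ _ _ q)).
transitivity (\int[distribution m (@pospart R : {RV m >-> R})]_x (g x)%:E)%E.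
  by apply: eq_measure_integral => A mA _; exact: distribution_quantile.
by rewrite (integral_distribution mEg (ib _ _ m (@pospart R : {RV m >-> R}))).
Qed.

End quantile.

(** * Weak convergence from convergence in mean *)

Section weak_limits.
Context (R : realType).

(** Only x is confined to a compact interval and y may leave it: in the application x is a value of
    the limit variable and y a value of an approximation, over which there is no control of size. *)
Lemma uniform_continuity_compact (g : R -> R) (K e : R) : continuous g -> 0 < e
  ->
  exists2 r, 0 < r & forall x y, `|x| <= K -> `|x - y| < r -> `|g x - g y| < e.
Proof.
move=> cg e0.
pose Q (r x : R) := forall y, `|x - y| < r -> `|g x - g y| < e.
have HQ x : `[- K, K]%classic x -> \forall x' \near x & r \near 0^'+, Q r x'.
  move=> _.
  have /cvgrPdist_lt/(_ (e / 2)) : g y @[y --> x] --> g x by exact: cg.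
  rewrite divr_gt0// => /(_ isT) [r /= r0 Hr].
  exists (ball x (r / 2), [set r' | 0 < r' < r / 2]) => /=.
    split; first by exists (r / 2) => //=; rewrite divr_gt0.
    exists (r / 2); first by rewrite /= divr_gt0.
    by move=> z /=; rewrite sub0r normrN => + z0; rewrite gtr0_norm// z0.
  move=> [x' r'] /= [xx' /andP[r'0 r'r]] y x'y.
  have h1 : `|g x - g x'| < e / 2.
    by apply: Hr => /=; apply: lt_le_trans xx' _;
      rewrite ler_pdivrMr// ler_pMr// ler1n.
  have h2 : `|g x - g y| < e / 2.
    apply: Hr => /=; rewrite -[x](subrK x') -addrA (le_lt_trans (ler_normD _
      _))//.
    rewrite [ltRHS](splitr r) ltrD// (lt_trans x'y)//.
  rewrite -[g x'](subrK (g x)) -addrA (le_lt_trans (ler_normD _ _))//.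
  by rewrite [ltRHS](splitr e) ltrD// distrC.
have [r0 /= r00 Hr] :=
  (compact_near_coveringP `[- K, K]%classic).1 (@segment_compact R (- K) K) _ _
    _ _ HQ.
exists (r0 / 2); first by rewrite divr_gt0.
move=> x y xK; apply: Hr; rewrite /= ?divr_gt0//.
  by rewrite sub0r normrN gtr0_norm ?divr_gt0// ltr_pdivrMr// ltr_pMr// ltr1n.
by rewrite in_itv/= -ler_norml.
Qed.

(** Three cases bound the change of g by an integrable expression. Where Z is at most K in absolute
    value and U n is within r of Z, uniform continuity applies. Where Z exceeds K, the change is at
    most 2b on an event of small probability. Where U n is at distance at least r from Z, 2b is at
    most 2b / r times that distance. *)
Lemma cvg_expectation_L1 d (T : measurableType d) (P : probability T R)
    (U : nat -> {RV P >-> R}) (Z : {RV P >-> R}) (g : R -> R) :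
  (\int[P]_w `|U n w - Z w|%:E)%E @[n --> \oo] --> 0%E ->
  continuous g -> bounded_fun g ->
  (\int[P]_w (g (U n w))%:E)%E @[n --> \oo] --> (\int[P]_w (g (Z w))%:E)%E.
Proof.
move=> UZ cg bg.
have [b0 Hb0] : exists b : R, forall x, `|g x| <= b.
  move: bg => [M [_ HM]]; exists (M + 1) => x; apply: (HM (M + 1)) => //.
  by rewrite ltrDl.
pose b : R := `|b0| + 1.
have b1 : 0 < b by rewrite /b addrC ltr_pwDl.
have Hb x : `|g x| <= b.
  by rewrite (le_trans (Hb0 x))// /b (le_trans (ler_norm _))// lerDl.
have mg : measurable_fun [set: R] g by exact: continuous_measurable_fun.
have mgX (X : {RV P >-> R}) : measurable_fun [set: T] (fun w => (g (X w))%:E).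
  by apply/measurable_EFinP; apply: measurableT_comp.
have igX (X : {RV P >-> R}) : P.-integrable setT (fun w => (g (X w))%:E).
  apply: (@le_integrable _ _ _ _ _ _ _ (fun=> b%:E)) => //.
    by move=> w _ /=; rewrite lee_fin (le_trans (Hb _))// ler_norm.
  apply/integrableP; split; first exact: measurable_cst.
  by rewrite integral_cst//= probability_setT mule1 ltry.
have fX (X : {RV P >-> R}) : (\int[P]_w (g (X w))%:E)%E \is a fin_num.
  exact: integrable_fin_num (igX X).
rewrite -(fineK (fX Z)).
apply/fine_cvgP; split; first by apply: nearW => n; exact: fX.
apply/cvgrPdist_le => /= e e0.
(* With 2b in front, this event contributes e / 4, as does uniform continuity; the threshold e r /
   (4 b) chosen below for the mean distance contributes the remaining e / 2. *)
have [K HK] : exists K : R, (P [set w | (K < `|Z w|)%R] <= (e / (8 * b))%:E)%E.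
  have mZ : measurable_fun [set: T] (fun w => `|Z w|) by exact:
    measurableT_comp.
  pose X : {RV P >-> R} := mfun_Sub (mem_set mZ).
  have cv : (fine \o ccdf X) y @[y --> +oo] --> (0 : R) by
    exact/fine_cvg/cvg_ccdfy0.
  have eb : 0 < e / (8 * b) by rewrite divr_gt0// mulr_gt0.
  have [A [_ HA]] := cvgr_lt _ cv _ eb.
  exists (A + 1); have /HA/= : A < A + 1 by rewrite ltrDl.
  move=> /ltW; rewrite -lee_fin fineK; last by rewrite fin_num_measure.
  apply: le_trans; rewrite le_eqVlt; apply/orP; left; apply/eqP; congr (P _).
  by apply/seteqP; split => w /=; rewrite in_itv/= andbT.
have e4 : 0 < e / 4 by rewrite divr_gt0.
have [r r0 Hr] := uniform_continuity_compact K cg e4.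
pose A := [set w | K < `|Z w|].
have mA : measurable A.
  have mZ : measurable_fun [set: T] (fun w => `|Z w|) by exact:
    measurableT_comp.
  have -> : A = (fun w => `|Z w|) @^-1` `]K, +oo[.
    by apply/seteqP; split => w /=; rewrite in_itv/= andbT.
  by rewrite -[X in measurable X]setTI; exact: mZ.
have mUZ n : measurable_fun [set: T] (fun w => `|U n w - Z w|%:E).
  by apply/measurable_EFinP; apply: measurableT_comp => //;
    exact: measurable_funB.
have br0 : 0 <= 2 * b / r by rewrite divr_ge0// ?mulr_ge0// ltW.
have pw n w : `|g (Z w) - g (U n w)| <=
    (e / 4 + (2 * b) * \1_A w) + 2 * b / r * `|U n w - Z w|.
  have h2b : `|g (Z w) - g (U n w)| <= 2 * b.
    by apply: (le_trans (ler_normB _ _)); rewrite mulr_natl mulr2n lerD ?Hb.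
  have [wA|wA] := pselect (A w).
    rewrite indicE mem_set//= mulr1 (le_trans h2b)//.
    by rewrite -addrA addrCA lerDl addr_ge0//; [exact: ltW|exact: mulr_ge0].
  rewrite indicE memNset//= mulr0 addr0.
  have [UZr|UZr] := ltP `|Z w - U n w| r.
    apply: (@le_trans _ _ (e / 4)); last by rewrite lerDl mulr_ge0.
    by apply/ltW/Hr => //; rewrite leNgt; apply/negP.
  rewrite (le_trans h2b)// (@le_trans _ _ (2 * b / r * `|U n w - Z w|))//.
    by rewrite distrC -mulrA ler_pMr ?mulr_gt0// mulrC ler_pdivlMr// mul1r.
  by rewrite lerDr ltW.
have bound n : (\int[P]_w `|(g (Z w))%:E - (g (U n w))%:E|
    <= (e / 2)%:E + (2 * b / r)%:E * \int[P]_w `|U n w - Z w|%:E)%E.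
  apply: (@le_trans _ _ (\int[P]_w (((e / 4)%:E + (2 * b)%:E * (\1_A w)%:E)
      + (2 * b / r)%:E * `|U n w - Z w|%:E))%E).
    apply: ge0_le_integral => //.
    - by apply: measurableT_comp => //; apply: emeasurable_funB.
    - apply: emeasurable_funD; last exact: measurable_funeM.
      apply: emeasurable_funD => //; apply: measurable_funeM.
      by apply/measurable_EFinP; exact: measurable_indic.
    - by move=> w _; rewrite -EFinB -!EFinM -!EFinD lee_fin.
  have m1 : measurable_fun [set: T] (fun w => (2 * b)%:E * (\1_A w)%:E)%E.
    by apply: measurable_funeM; apply/measurable_EFinP; exact: measurable_indic.
  rewrite ge0_integralD//; last 4 first.
  - by move=> w _; rewrite -EFinM -EFinD lee_fin addr_ge0 ?mulr_ge0// ltW.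
  - exact: emeasurable_funD.
  - by move=> w _; rewrite -EFinM lee_fin mulr_ge0.
  - exact: measurable_funeM.
  rewrite ge0_integralD//; last 2 first.
  - by move=> w _; rewrite lee_fin ltW.
  - by move=> w _; rewrite -EFinM lee_fin !mulr_ge0// ltW.
  rewrite integral_cst//= probability_setT mule1.
  rewrite ge0_integralZl//; last 2 first.
  - by apply/measurable_EFinP; exact: measurable_indic.
  - by rewrite lee_fin mulr_ge0// ltW.
  rewrite integral_indic// setIT ge0_integralZl//.
  rewrite leeD2r// [in leRHS](_ : e / 2 = e / 4 + 2 * b * (e / (8 * b)));
    last first.
    by field; rewrite gt_eqF.
  by rewrite EFinD leeD2l// [leRHS]EFinM lee_pmul// ?lee_fin ?mulr_ge0// ltW.
have /fine_cvgP[UZfin UZ0] := UZ.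
have er : 0 < e * r / (4 * b) by rewrite !(divr_gt0, mulr_gt0).
near=> n.
have UZn : (\int[P]_w `|U n w - Z w|%:E)%E \is a fin_num by near: n;
  exact: UZfin.
have small : fine (\int[P]_w `|U n w - Z w|%:E)%E < e * r / (4 * b).
  by near: n; exact: (cvgr_lt _ UZ0).
suff : (`|\int[P]_w (g (Z w))%:E - \int[P]_w (g (U n w))%:E| <= e%:E)%E.
  by rewrite -{1}(fineK (fX Z)) -{1}(fineK (fX (U n))) -EFinB abse_EFin lee_fin.
rewrite -integralB//; apply: (le_trans (le_abse_integral _ _ _)) => //.
  exact: emeasurable_funB.
apply: (le_trans (bound n)).
rewrite -(fineK UZn) -EFinM -EFinD lee_fin.
have : 2 * b / r * fine (\int[P]_w `|U n w - Z w|%:E)%E <= 2 * b / r * (e * r /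
  (4 * b)).
  by rewrite ler_wpM2l// ltW.
rewrite (_ : 2 * b / r * (e * r / (4 * b)) = e / 2); first lra.
by field; rewrite ?gt_eqF.
Unshelve. all: end_near. Qed.

End weak_limits.

(** * Limits of quantiles under stochastic domination *)

Section stochastic_domination.
Context (R : realType).

Lemma markov_ptail (m : probability R R) x : 0 <= x ->
  (x%:E * ptail m x <= pmean m)%E.
Proof.
move=> x0; have mx := measurable_ptail_set x.
rewrite /ptail -[X in (_ * m X)%E]setIT -integral_indic//.
rewrite -ge0_integralZl//; last by apply/measurable_EFinP;
  exact: measurable_indic.
apply: ge0_le_integral => //.
- by move=> y _; rewrite -EFinM lee_fin mulr_ge0.
- by apply: measurable_funeM; apply/measurable_EFinP; exact: measurable_indic.
- by apply/measurable_EFinP; exact: measurable_pospart.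
- move=> y _; rewrite -EFinM lee_fin indicE.
  have [|] := boolP (y \in _); last by rewrite mulr0 pospart_ge0.
  by rewrite inE/= mulr1 => /ltW.
Qed.

Variables (m t : nat -> probability R R) (M : R) (e : nat -> R).
Hypothesis m_nd : forall n x, (ptail (m n) x <= ptail (m n.+1) x)%E.
Hypothesis m_bounded : forall n, (pmean (m n) <= M%:E)%E.
Hypothesis mt : forall n x, (ptail (m n) x <= ptail (t n) x)%E.
Hypothesis tm : forall n, (pmean (t n) <= pmean (m n) + (e n)%:E)%E.
Hypothesis e0 : e n @[n --> \oo] --> 0.

Let H n := fine \o ptail (m n).
Let Hoo x := sup (range (fun n => H n x)).

Let Hle1 n x : H n x <= 1.
Proof. by rewrite -lee_fin fineK ?ptail_fin// ptail_le1. Qed.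

Let ubH x : has_ubound (range (fun n => H n x)).
Proof. by exists 1 => _ [n _ <-]. Qed.

Let HHoo n x : H n x <= Hoo x.
Proof. by apply: ub_le_sup => //; exists n. Qed.

Let H_nd x n k : (n <= k)%N -> H n x <= H k x.
Proof.
elim: k => [|k IH]; first by rewrite leqn0 => /eqP ->.
rewrite leq_eqVlt => /orP[/eqP -> //|/IH]; move/le_trans; apply.
by rewrite /H/= fine_le ?ptail_fin.
Qed.

Let lt_Hoo v x : v < Hoo x -> exists n, v < H n x.
Proof.
move=> vH; have [_ [n _ <-] h] : exists2 y, range (fun n => H n x) y & v < y.
  by apply: sup_gt => //; exists (H 0 x); exists 0%N.
by exists n.
Qed.

Let M0 : 0 <= M.
Proof. by rewrite -lee_fin (le_trans _ (m_bounded 0))// pmean_ge0. Qed.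

(** A strict inequality v < Hoo x already holds for some H n, which transfers right continuity.
    Without the bound on the means mass could escape to infinity; Markov's inequality, uniform in n,
    excludes this. *)
Let tail_Hoo : tail_fun Hoo.
Proof.
split=> [x y xy|v x /lt_Hoo[n vn]|v v0].
- apply: ge_sup; first by exists (H 0 y); exists 0%N.
  move=> _ [n _ <-]; apply: le_trans (HHoo n x).
  by have [h _ _] := tail_fun_ptail (m n); exact: h.
- have [_ h _] := tail_fun_ptail (m n); have [y xy vy] := h _ _ vn.
  by exists y => //; exact: lt_le_trans (HHoo n y).
(* M + 1 instead of M keeps the witness positive when M = 0. *)
- have y0 : 0 < (M + 1) / v by rewrite divr_gt0// ltr_wpDl.
  exists ((M + 1) / v); first exact: ltW.
  apply: ge_sup; first by exists (H 0 ((M + 1) / v)); exists 0%N.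
  move=> _ [n _ <-].
  have := le_trans (markov_ptail (m n) (ltW y0)) (m_bounded n).
  rewrite -(fineK (ptail_fin _ _)) -EFinM lee_fin -/(H n _) => h.
  rewrite -(ler_pM2l y0) (le_trans h)// divfK ?gt_eqF//.
  by rewrite lerDl.
Qed.

Let q n := quantile_rv (tail_fun_ptail (m n)).
Let u n := quantile_rv (tail_fun_ptail (t n)).
Let Z := quantile_rv tail_Hoo.

Let q_ge0 n v : 0 <= q n v. Proof. exact/quantile_ge0/tail_fun_ptail. Qed.
Let u_ge0 n v : 0 <= u n v. Proof. exact/quantile_ge0/tail_fun_ptail. Qed.
Let Z_ge0 v : 0 <= Z v. Proof. exact/quantile_ge0. Qed.

Let qZ n v : q n v <= Z v.
Proof. exact: (le_quantile _ (tail_fun_ptail _) tail_Hoo (HHoo n)). Qed.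

Let qu n v : q n v <= u n v.
Proof.
apply: (le_quantile _ (tail_fun_ptail _) (tail_fun_ptail _)) => x.
by rewrite /= fine_le ?ptail_fin.
Qed.

Let q_nd v n k : (n <= k)%N -> q n v <= q k v.
Proof.
move=> nk; apply: (le_quantile _ (tail_fun_ptail _) (tail_fun_ptail _)) => x.
exact: H_nd.
Qed.

(** The quantiles increase, and their supremum s cannot stay below Z v: s < Z v would mean v < Hoo
    s, hence v < H n s for some n, which is s < q n v. *)
Let q_cvg v : q n v @[n --> \oo] --> Z v.
Proof.
have ub : has_ubound (range (fun n => q n v)) by exists (Z v) => _ [n _ <-].
suff -> : Z v = sup (range (fun n => q n v)).
  by apply: nondecreasing_cvgn => // n k; exact: q_nd.
apply/eqP; rewrite eq_le; apply/andP; split; last first.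
  by apply: ge_sup; [exists (q 0%N v); exists 0%N|move=> _ [n _ <-]].
set s := sup _; have qs n : q n v <= s by apply: ub_le_sup => //; exists n.
have s0 : 0 <= s by exact: le_trans (qs 0%N).
have [v0|v0] := ltP 0 v; last by rewrite /Z/= /quantile (ltNge 0 v) v0.
rewrite leNgt; apply/negP; rewrite /Z/= lt_quantile// => /lt_Hoo[n vn].
have : s < q n v by rewrite /q/= lt_quantile//; exact: tail_fun_ptail.
by rewrite ltNge qs.
Qed.

Let mE (X : {RV (unif01 R) >-> R}) : measurable_fun setT (fun v => (X v)%:E).
Proof. exact/measurable_EFinP. Qed.

Let EZ := (\int[unif01 R]_v (Z v)%:E)%E.

Let pmean_cvg : pmean (m n) @[n --> \oo] --> EZ.
Proof.
have -> : (fun n => pmean (m n)) = (fun n => \int[unif01 R]_v (q n v)%:E)%E.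
  by apply/funext => n; rewrite -integral_quantile_pos.
have -> : EZ = (\int[unif01 R]_v limn (fun n => (q n v)%:E))%E.
  apply: eq_integral => v _; apply/esym/cvg_lim => //.
  by apply/cvg_EFin; [exact: nearW|exact: q_cvg].
apply: cvg_monotone_convergence => // [n v _|v _ n k nk].
- by rewrite lee_fin.
- by rewrite lee_fin; exact: q_nd.
Qed.

Let EZ_fin : EZ \is a fin_num.
Proof.
rewrite ge0_fin_numE; last by apply: integral_ge0 => v _; rewrite lee_fin.
rewrite (@le_lt_trans _ _ M%:E) ?ltry//.
by apply: (cvge_le _ pmean_cvg); exact: nearW.
Qed.

Let pmean_m_fin n : pmean (m n) \is a fin_num.
Proof. by rewrite ge0_fin_numE ?pmean_ge0// (le_lt_trans (m_bounded n))// ltry.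
Qed.

Let pmean_t_fin n : pmean (t n) \is a fin_num.
Proof.
rewrite ge0_fin_numE ?pmean_ge0// (le_lt_trans (tm n))//.
by rewrite -(fineK (pmean_m_fin n)) -EFinD ltry.
Qed.

Let fine_pmean_m_cvg : fine (pmean (m n)) @[n --> \oo] --> fine EZ.
Proof. by apply: fine_cvg; rewrite fineK. Qed.

Lemma pmean_dominated_cvg : cvg (fine (pmean (t n)) @[n --> \oo]).
Proof.
apply/cvg_ex; exists (fine EZ).
have c : fine (pmean (m n)) + e n @[n --> \oo] --> fine EZ + 0.
  exact: cvgD.
rewrite addr0 in c.
apply: squeeze_cvgr fine_pmean_m_cvg c; apply: nearW => n.
apply/andP; split.
  rewrite fine_le// !pmean_ptail; apply: ge0_le_integral => //.
  - by apply: measurable_funTS; exact: measurable_ptail.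
  - by apply: measurable_funTS; exact: measurable_ptail.
by rewrite -lee_fin EFinD !fineK.
Qed.

(** Since q lies below both u and Z, the distance of u and Z is at most u + Z - 2q pointwise. The
    integral of this bound is a combination of means that tends to 0, so convergence of means is
    upgraded to convergence in L^1. *)
Let L1_cvg : (\int[unif01 R]_v `|u n v - Z v|%:E)%E @[n --> \oo] --> 0%E.
Proof.
have c : ((fine EZ - fine (pmean (m n)) + e n)%:E @[n --> \oo] --> 0%:E)%E.
  apply/cvg_EFin; first exact: nearW.
  rewrite -[0](addr0 0) -{1}(subrr (fine EZ)); apply: cvgD => //.
  by apply: cvgB => //; exact: cvg_cst.
apply: squeeze_cvge (cvg_cst _) c; apply: nearW => n.
apply/andP; split; first by apply: integral_ge0 => v _; rewrite lee_fin.
have mU : measurable_fun setT (fun v => `|u n v - Z v|%:E).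
  by apply/measurable_EFinP; apply: measurableT_comp => //;
    exact: measurable_funB.
set I := (\int[_]_v _)%E.
(* The inequality is kept in terms of sums of nonnegative quantities; the subtraction waits until
   [I] is known to be finite. *)
have : (I + 2%:E * pmean (m n) <= pmean (t n) + EZ)%E.
  rewrite -!integral_quantile_pos /I /EZ -ge0_integralZl//.
  rewrite -!ge0_integralD//.
  - apply: ge0_le_integral => //.
    + by move=> v _; rewrite -EFinM -EFinD lee_fin addr_ge0 ?mulr_ge0//;
      exact: q_ge0.
    + by apply: emeasurable_funD => //; apply: measurable_funeM;
      exact: (mE (q n)).
    + by apply: emeasurable_funD; [exact: (mE (u n))|exact: (mE Z)].
    + move=> v _; rewrite -EFinM -!EFinD lee_fin -/(q n v) -/(u n v).
      have := qu n v; have := qZ n v; rewrite /u/q/Z/= => h1 h2.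
      by rewrite -lerBrDr ler_norml; apply/andP; split; lra.
  - by move=> v _; rewrite lee_fin; exact: u_ge0.
  - exact: (mE (u n)).
  - by move=> v _; rewrite lee_fin.
  - by move=> v _; rewrite -EFinM lee_fin mulr_ge0//; exact: q_ge0.
  - by apply: measurable_funeM; exact: (mE (q n)).
  - exact: (mE (q n)).
  - by move=> v _; rewrite lee_fin; exact: q_ge0.
have I0 : (0 <= I)%E by apply: integral_ge0 => v _; rewrite lee_fin.
move=> h; have {}h := le_trans h (leeD2r EZ (tm n)).
have If : I \is a fin_num.
  rewrite ge0_fin_numE// (@le_lt_trans _ _ (pmean (m n) + (e n)%:E + EZ)%E)//.
    by apply: le_trans h; rewrite leeDl// mule_ge0// pmean_ge0.
  by rewrite -(fineK (pmean_m_fin n)) -(fineK EZ_fin) -!EFinD ltry.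
move: h; rewrite -(fineK (pmean_m_fin n)) -(fineK EZ_fin) -(fineK If).
by rewrite -EFinM -!EFinD !lee_fin; lra.
Qed.

Lemma dominated_weak_limit : exists Z : {RV (unif01 R) >-> R},
  forall g : R -> R, continuous g -> bounded_fun g ->
    (\int[t n]_x (g (pospart x))%:E)%E @[n --> \oo] -->
    (\int[unif01 R]_v (g (Z v))%:E)%E.
Proof.
exists Z => g cg bg; have mg : measurable_fun [set: R] g by exact:
  continuous_measurable_fun.
have [b Hb] : exists b : R, forall x, `|g x| <= b.
  move: bg => [K [_ HK]]; exists (K + 1) => x; apply: (HK (K + 1)) => //.
  by rewrite ltrDl.
under eq_fun do rewrite -(integral_quantile_bounded _ mg Hb).
exact: (cvg_expectation_L1 (U := u)).
Qed.

End stochastic_domination.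

(** * Decoupling of disjoint blocks of independent variables *)

Section independent_blocks.
Context (R : realType) d (T : measurableType d) (P : probability T R).
Context (I : finType) (X : I -> {RV P >-> R}).
Hypothesis indepX : mutually_independent X.
Implicit Types (J K : {set I}) (A : I -> set R).

Definition block J : set (set T) :=
  [set B | exists2 A, forall i, measurable (A i) &
     B = \bigcap_(i in [set` J]) (X i @^-1` A i)].

(* T itself, with the sigma-algebra generated by the X i for i in J. *)
Definition blockT J := g_sigma_algebraType (block J).

Lemma measurable_block J B : block J B -> measurable B.
Proof.
move=> [A mA ->]; apply: fin_bigcap_measurable; first exact: finite_finset.
by move=> i _; rewrite -[X in measurable X]setTI; exact: measurable_funPT.
Qed.

Lemma measurable_blockT J (B : set (blockT J)) : measurable B ->
  measurable (B : set T).
Proof.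
apply: (@smallest_sub _ _ (block J) (@measurable _ T));
  last exact: measurable_block.
exact: sigma_algebra_measurable.
Qed.

Lemma block_setI J : setI_closed (block J).
Proof.
move=> _ _ [A mA ->] [B mB ->]; exists (fun i => A i `&` B i).
  by move=> i; exact: measurableI.
by rewrite -bigcapI.
Qed.

Lemma blockT_setT J : block J setT.
Proof.
exists (fun=> setT) => //.
by apply/seteqP; split => // x _ i _.
Qed.

Lemma measurable_blockT_fun J i : i \in J ->
  measurable_fun [set: blockT J] (X i : blockT J -> R).
Proof.
move=> iJ _ B mB; rewrite setTI; apply: sub_sigma_algebra.
exists (fun k => if k == i then B else setT) => [k|]; first by case: ifP.
apply/seteqP; split => [x Bx k /= kJ|x /(_ i iJ)]; last by rewrite eqxx.
by case: eqP => // ->.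
Qed.

Definition to_block J (w : T) : blockT J := w.

Lemma measurable_to_block J : measurable_fun [set: T] (to_block J).
Proof. by move=> _ B mB; rewrite setTI; exact: (measurable_blockT mB). Qed.

HB.instance Definition _ J :=
  isMeasurableFun.Build _ _ _ _ (to_block J) (@measurable_to_block J).

(** The restriction of [P] to the sigma-algebra of the block, obtained as an image under the
    identity. *)
Definition Pblock J : probability (blockT J) R := distribution P (to_block J).

Lemma block_independent0 J K a b : [disjoint J & K]%B -> block J a -> block K b
  ->
  P (a `&` b) = (P a * P b)%E.
Proof.
move=> JK [A mA ->] [B mB ->]; rewrite !indepX//.
pose C i := if i \in J then A i else B i.
have mC i : measurable (C i) by rewrite /C; case: ifP.
have JKF i : i \in K -> (i \in J) = false.
  by move=> iK; rewrite (disjointFl JK iK).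
transitivity (P (\bigcap_(i in [set` J :|: K]) (X i @^-1` C i))).
  congr (P _); apply/seteqP; split => x.
    move=> [xA xB] i /=; rewrite inE /C; case: ifP => [iJ _|_ /= iK].
      exact: xA.
    exact: xB.
  move=> xC; split => i /= iJ.
    by have := xC i; rewrite /= inE iJ /C iJ; exact.
  by have := xC i; rewrite /= inE iJ orbT /C JKF//; exact.
rewrite indepX// (eq_bigl [predU J & K]); last by move=> i; rewrite !inE.
rewrite bigU//=.
congr (_ * _)%E; apply: eq_bigr => i iJ; rewrite /C ?iJ//.
by rewrite JKF.
Qed.

(** For fixed B both sides are finite measures in a, so agreement on the generating pi-system
    suffices. It is applied once for each factor in [block_independent]. *)
Lemma block_independent_ext J (B : set T) : measurable B ->
  (forall a, block J a -> P (a `&` B) = (P a * P B)%E) ->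
  forall a : set (blockT J), measurable a -> P ((a : set T) `&` B) = (P a * P
    B)%E.
Proof.
move=> mB HB a ma.
have PB0 : 0 <= fine (P B) by rewrite fine_ge0.
pose m1' : {measure set (blockT J) -> \bar R} :=
  pushforward (mrestr P mB) (to_block J).
pose m1 := m1' (@measurable_to_block J).
pose m2 : {measure set (blockT J) -> \bar R} := mscale (NngNum PB0) (Pblock J).
have cov : \bigcup_(k : nat) ([set: blockT J]) = setT.
  by apply/seteqP; split => // x _; exists 0%N.
have : m1 a = m2 a.
  have U := @measure_unique _ R (blockT J) (block J) (fun=> setT) (erefl _)
    (@block_setI J) (fun=> blockT_setT J) cov m1 m2.
  apply: U => // [b Jb|_].
    rewrite /m1 /m1' /m2 /= /pushforward/= /mrestr/= /mscale/=.
    by rewrite [LHS](HB _ Jb) fineK ?fin_num_measure// muleC.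
  rewrite /m1 /m1' /= /pushforward/= /mrestr/=.
  by rewrite preimage_setT setTI (le_lt_trans (probability_le1 P mB))// ltry.
rewrite /m1 /m1' /m2 /= /pushforward/= /mrestr/= /mscale/= => ->.
by rewrite fineK ?fin_num_measure// muleC.
Qed.

Lemma block_independent J K (a : set (blockT J)) (b : set (blockT K)) :
  [disjoint J & K]%B -> measurable a -> measurable b ->
  P ((a : set T) `&` b) = (P a * P b)%E.
Proof.
move=> JK ma mb.
apply: block_independent_ext ma; first exact: measurable_blockT mb.
move=> a0 Ja0; rewrite setIC muleC.
apply: block_independent_ext mb; first exact: measurable_block Ja0.
by move=> b0 Kb0; rewrite setIC muleC; exact: block_independent0 JK _ _.
Qed.

(** One outcome seen through two sigma-algebras. Independence of the blocks amounts to the law of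
    this map being the product of the two restrictions of [P]. *)
Definition diag_block J K (w : T) : blockT J * blockT K := (w, w).

Lemma measurable_diag_block J K : measurable_fun [set: T] (diag_block J K).
Proof.
by apply: measurable_fun_pair; exact: measurable_to_block.
Qed.

HB.instance Definition _ J K :=
  isMeasurableFun.Build _ _ _ _ (diag_block J K) (@measurable_diag_block J K).

Lemma diag_blockE J K (D : set (blockT J * blockT K)) : [disjoint J & K]%B ->
  measurable D ->
  distribution P (diag_block J K) D = (Pblock J \x Pblock K)%E D.
Proof.
move=> JK mD; apply/esym; apply: product_measure_unique => // A B mA mB.
by rewrite [LHS](block_independent JK mA mB).
Qed.

Lemma integral_Pblock J (f : blockT J -> \bar R) : measurable_fun setT f ->
  (forall x, 0 <= f x)%E -> (\int[Pblock J]_x f x = \int[P]_x f x)%E.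
Proof. by move=> mf f0; rewrite ge0_integral_distribution. Qed.

(** This replaces conditional expectations throughout: the edges of the block [K] are integrated
    first, with the outcome x of the block [J] frozen. *)
Lemma decouple J K (H : blockT J * blockT K -> \bar R) : [disjoint J & K]%B ->
  measurable_fun setT H -> (forall z, 0 <= H z)%E ->
  (\int[P]_w H (w, w) = \int[P]_x \int[P]_y H (x, y))%E.
Proof.
move=> JK mH H0.
transitivity (\int[distribution P (diag_block J K)]_z H z)%E.
  by rewrite ge0_integral_distribution.
transitivity (\int[(Pblock J \x Pblock K)%E]_z H z)%E.
  by apply: eq_measure_integral => D mD _; exact: diag_blockE.
rewrite fubini_tonelli1//.
have mF : measurable_fun setT (fubini_F (Pblock K) H).
  exact: measurable_fun_fubini_tonelli_F.
rewrite [LHS](integral_Pblock mF); last by move=> x; exact: integral_ge0.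
apply: eq_integral => x _; apply: integral_Pblock => //.
exact: measurableT_comp.
Qed.

End independent_blocks.

(** * Greedy paths and nearest neighbour tours *)

Section greedy_paths.
Context (R : realType) (N : nat).
Implicit Types (c : 'I_N -> 'I_N -> R) (V : {set 'I_N}) (u w x : 'I_N).

Definition nearest c V u w : bool := [forall (w' | w' \in V :\ w), c u w < c u
  w'].

(* Length of the greedy path from u through the k cities of V.  In case of a tie
   no city is nearest and the sum has no nonzero term. *)
Fixpoint path_length c k V u : R :=
  if k is k'.+1 then
    \sum_(w in V) (nearest c V u w)%:R * (c u w + path_length c k' (V :\ w) w)
  else 0.

Fixpoint path_end c k V u x : bool :=
  if k is k'.+1 then
    [exists (w | w \in V), nearest c V u w && path_end c k' (V :\ w) w x]
  else x == u.

(** Only edges with a common endpoint are compared, as a greedy step never compares others. *)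
Definition tie_free c := forall i j k, i != j -> i != k -> j != k -> c i j != c
  i k.

Lemma nearest_unique c V u w w' : w \in V -> w' \in V ->
  nearest c V u w -> nearest c V u w' -> w = w'.
Proof.
move=> wV w'V /forallP/(_ w') h /forallP/(_ w) h'.
apply/eqP; apply: contraT => ww'.
move: h h'; rewrite !inE ww' eq_sym ww' wV w'V /= => h h'.
by have := lt_trans h h'; rewrite ltxx.
Qed.

Lemma sum_nearest c V u (g : 'I_N -> R) w : w \in V -> nearest c V u w ->
  \sum_(w' in V) (nearest c V u w')%:R * g w' = g w.
Proof.
move=> wV nw; rewrite (bigD1 w)//= nw mul1r big1 ?addr0// => w' /andP[w'V w'w].
case nw': (nearest c V u w'); last by rewrite mul0r.
by rewrite (nearest_unique w'V wV nw' nw) eqxx in w'w.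
Qed.

Lemma path_lengthS c k V u w : w \in V -> nearest c V u w ->
  path_length c k.+1 V u = c u w + path_length c k (V :\ w) w.
Proof. exact: sum_nearest. Qed.

Lemma path_endS c k V u w x : w \in V -> nearest c V u w ->
  path_end c k.+1 V u x = path_end c k (V :\ w) w x.
Proof.
move=> wV nw /=; apply/existsP/idP => [[w' /andP[w'V /andP[nw' h]]]|h].
  by rewrite (nearest_unique wV w'V nw nw').
by exists w; rewrite wV nw.
Qed.

Lemma path_length_ge0 c k V u : (forall i j, 0 <= c i j) -> 0 <= path_length c
  k V u.
Proof.
move=> c0; elim: k V u => [|k IH] V u //=.
by apply: sumr_ge0 => w _; rewrite mulr_ge0 ?addr_ge0.
Qed.

Lemma nearest_exists c V u : tie_free c -> u \notin V -> V != finset.set0 ->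
  exists2 w, w \in V & nearest c V u w.
Proof.
move=> tf uV /set0Pn[w0 w0V].
case: (@Order.TotalTheory.arg_minP _ _ _ w0 (mem V) (c u) w0V) => w wV wmin.
exists w => //; apply/forallP => w'; apply/implyP;
  rewrite !inE => /andP[w'w w'V].
rewrite lt_neqAle wmin// andbT; apply: tf; rewrite 1?eq_sym//.
  by apply: contraNneq uV => <-.
by apply: contraNneq uV => <-.
Qed.

Lemma sum_nearest1 c V u : tie_free c -> u \notin V -> V != finset.set0 ->
  \sum_(w in V) (nearest c V u w)%:R = 1 :> R.
Proof.
move=> tf uV V0; have [w wV nw] := nearest_exists tf uV V0.
apply: etrans (sum_nearest (fun=> 1) wV nw).
by apply: eq_bigr => w' _; rewrite mulr1.
Qed.

Lemma path_end_in c k V u x : path_end c k.+1 V u x -> x \in V.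
Proof.
elim: k V u => [|k IH] V u /existsP[w /andP[wV /andP[_ h]]].
  by move: h => /= /eqP ->.
by have := IH _ _ h; rewrite !inE => /andP[].
Qed.

(** Taken with g = 1, it shows that, in the absence of ties, the events indexed by the possible ends
    of the path form a partition. *)
Lemma sum_path_end c k V u (g : 'I_N -> R) :
  tie_free c -> u \notin V -> #|V| = k.+1 ->
  exists2 x, x \in V & \sum_(x' in V) (path_end c k.+1 V u x')%:R * g x' = g x.
Proof.
move=> tf; elim: k V u => [|k IH] V u uV cV.
all: have V0 : V != finset.set0 by rewrite -card_gt0 cV.
all: have [w wV nw] := nearest_exists tf uV V0.
  exists w => //; rewrite (bigD1 w)//= big1 ?addr0 => [|x' /andP[_ x'w]].
    by rewrite -/(path_end c 1 V u w) (path_endS _ _ wV nw)/= eqxx mul1r.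
  by rewrite -/(path_end c 1 V u x') (path_endS _ _ wV nw)/= (negbTE x'w) mul0r.
have cVw : #|V :\ w| = k.+1 by have := cardsD1 w V; rewrite wV cV => -[].
have wVw : w \notin V :\ w by rewrite !inE eqxx.
have [x xVw E] := IH (V :\ w) w wVw cVw.
exists x; first by move: xVw; rewrite !inE => /andP[].
rewrite -E (big_setD1 w)//= [X in X + _](_ : _ = 0).
  rewrite add0r; apply: eq_bigr => x' _.
  by rewrite -[[exists _, _]]/(path_end c k.+2 V u x') (path_endS _ _ wV nw).
rewrite -[[exists _, _]]/(path_end c k.+2 V u w) (path_endS _ _ wV nw).
case h: (path_end _ _ _ _ _); last by rewrite mul0r.
by have := path_end_in h; rewrite (negbTE wVw).
Qed.

End greedy_paths.

(** * Nearest neighbour tours as greedy paths *)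

Section nearest_neighbour_tour.
Context (R : realType) (n : nat).

Lemma nn_tour_unvisited (l : 'I_n.+1 -> 'I_n.+1 -> R) (v : nat -> 'I_n.+1) i j :
  is_nn_tour l v -> (i < j <= n)%N -> v j != v i.
Proof.
move=> [_ _ H] /andP[ij jn]; case: j ij jn => // j ij jn.
by apply/eqP; have [h _] := H j jn; exact: h.
Qed.

Lemma nn_tour_step (l : 'I_n.+1 -> 'I_n.+1 -> R) (v : nat -> 'I_n.+1) i :
  is_nn_tour l v -> (0 < n)%N -> (i <= n)%N -> v i != v i.+1.
Proof.
move=> tv n0; rewrite leq_eqVlt => /orP[/eqP ->|lin].
  have [v0 vn _] := tv; rewrite vn -v0.
  by apply: nn_tour_unvisited tv _; rewrite n0 leqnn.
by rewrite eq_sym; apply: nn_tour_unvisited tv _; rewrite ltnSn.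
Qed.

(** Without ties the costs determine the tour, so every admissible [v] gives the same functional of
    [c]. That functional is measurable in the costs, while nothing is known about the dependence of
    [v] on the outcome. With n = 0 the only edge would be the diagonal one, where [l] and [c] may
    differ. *)
Lemma nn_tour_lengthE (l c : 'I_n.+1 -> 'I_n.+1 -> R) (v : nat -> 'I_n.+1) :
  (0 < n)%N -> (forall i j, i != j -> l i j = c i j) ->
  (forall i j, c i j = c j i) -> tie_free c ->
  is_nn_tour l v ->
  tour_length l v = path_length c n [set~ ord0] ord0 +
    \sum_(x in [set~ ord0]%SET) (path_end c n [set~ ord0] ord0 x)%:R * c ord0 x.
Proof.
move=> n0 lc cC tf tv; have [v0 vn H] := tv.
pose U i := [set u | [forall j : 'I_i.+1, u != v j]]%SET.
have UP i u : reflect (forall j, (j <= i)%N -> u <> v j) (u \in U i).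
  rewrite inE; apply: (iffP forallP) => [h j ji|h j].
    by apply/eqP; exact: (h (Ordinal (ji : j < i.+1)%N)).
  by apply/eqP; apply: h; rewrite -ltnS.
have step i : (i < n)%N -> v i.+1 \in U i /\ nearest c (U i) (v i) (v i.+1).
  move=> lin; have [h1 h2] := H i lin; split; first exact/UP.
  apply/forallP => w; apply/implyP; rewrite in_setD1 => /andP[wv wU].
  have wvi : v i != w by apply/eqP => e; move/UP: wU => /(_ i (leqnn _));
    rewrite e.
  have vvi : v i != v i.+1 by apply: nn_tour_step tv n0 (ltnW lin).
  rewrite lt_neqAle tf//=; last by rewrite eq_sym.
  rewrite -!lc//; apply: h2; exact/UP.
have UD i : U i :\ v i.+1 = U i.+1.
  apply/setP => u; rewrite in_setD1; apply/andP/UP.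
    move=> [uv /UP h] j; rewrite leq_eqVlt => /orP[/eqP ->|]; first exact/eqP.
    by rewrite ltnS; exact: h.
  move=> h; split; first by apply/eqP; exact: h.
  by apply/UP => j ji; apply: h; exact: leq_trans ji _.
have main k i : (i + k = n)%N ->
    path_length c k (U i) (v i) = \sum_(i <= j < n) c (v j) (v j.+1) /\
    forall x, path_end c k (U i) (v i) x = (x == v n).
  elim: k i => [|k IH] i; first by rewrite addn0 => ->; rewrite big_geq.
  rewrite addnS -addSn => ikn.
  have lin : (i < n)%N by rewrite -ikn ltnS leq_addr.
  have [vU nv] := step i lin; have [IH1 IH2] := IH _ ikn.
  rewrite (path_lengthS _ vU nv) UD IH1 [in RHS]big_ltn//; split => // x.
  by rewrite (path_endS _ _ vU nv) UD.
have U0 : U 0%N = [set~ ord0]%SET.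
  apply/setP => u; rewrite in_setC1 -v0; apply/UP/idP => [h|/eqP h j].
    by apply/eqP; exact: h.
  by rewrite leqn0 => /eqP ->.
have [m1 m2] := main n 0%N (add0n n); rewrite U0 v0 in m1 m2.
rewrite m1 /tour_length big_ord_recr/= big_mkord; congr (_ + _).
  apply: eq_bigr => i _; apply: lc; apply: nn_tour_step tv n0 (ltnW _).
  exact: ltn_ord.
have vn0 : v n != ord0 by rewrite -v0; apply: nn_tour_unvisited tv _;
  rewrite n0 leqnn.
rewrite (bigD1 (v n))/=; last by rewrite in_setC1.
rewrite m2 eqxx mul1r big1 ?addr0 ?vn; last first.
  by move=> x /andP[_ xv]; rewrite m2 (negbTE xv) mul0r.
by rewrite lc// cC.
Qed.

End nearest_neighbour_tour.

(** * The law of the greedy path *)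

Section measurable_bool.
Context d (T : measurableType d) (R : realType).

Lemma measurable_all (I : Type) (s : seq I) (b : I -> T -> bool) :
  (forall i, measurable_fun [set: T] (b i)) ->
  measurable_fun [set: T] (fun w => all (b ^~ w) s).
Proof.
move=> mb; elim: s => [|i s IH] /=; first exact: measurable_cst.
exact: measurable_and.
Qed.

Lemma measurable_forall (I : finType) (b : I -> T -> bool) :
  (forall i, measurable_fun [set: T] (b i)) ->
  measurable_fun [set: T] (fun w => [forall i, b i w]).
Proof.
move=> mb; rewrite (_ : (fun _ => _) = (fun w => all (b ^~ w) (enum I))).
  exact: measurable_all.
apply/funext => w; apply/forallP/allP => [h i _|h i]; first exact: h.
by apply: h; rewrite mem_enum.
Qed.

Lemma measurable_exists (I : finType) (b : I -> T -> bool) :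
  (forall i, measurable_fun [set: T] (b i)) ->
  measurable_fun [set: T] (fun w => [exists i, b i w]).
Proof.
move=> mb; rewrite (_ : (fun _ => _) = (fun w => ~~ [forall i, ~~ b i w])).
  by apply: measurable_neg; apply: measurable_forall => i;
    exact: measurable_neg.
by apply/funext => w; rewrite negb_forall; apply: eq_existsb => i;
  rewrite negbK.
Qed.

Lemma measurable_natr_bool (b : T -> bool) : measurable_fun [set: T] b ->
  measurable_fun [set: T] (fun w => (b w)%:R : R).
Proof.
move=> mb; rewrite (_ : (fun _ => _) = (fun w => if b w then 1 else 0 : R)).
  by apply: measurable_fun_ifT => //; exact: measurable_cst.
by apply/funext => w; case: (b w).
Qed.

Lemma measurable_set_bool (b : T -> bool) : measurable_fun [set: T] b ->
  measurable [set w | b w].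
Proof.
move=> mb; rewrite (_ : [set _ | _] = b @^-1` [set true]).
  by rewrite -[X in measurable X]setTI; exact: mb.
by apply/seteqP; split.
Qed.

Lemma integral_natr_bool (P : probability T R) (b : T -> bool) :
  measurable_fun [set: T] b ->
  (\int[P]_w (b w)%:R%:E = P [set w | b w])%E.
Proof.
move=> mb; rewrite -[in RHS](setIT [set w | b w]) -integral_indic//.
  by apply: eq_integral => w _; rewrite indicE mem_setE.
exact: measurable_set_bool.
Qed.

End measurable_bool.

Section measurable_paths.
Context d (T : measurableType d) (R : realType) (N : nat).
Variable c : T -> 'I_N -> 'I_N -> R.
Implicit Types (V : {set 'I_N}) (u w : 'I_N).

Lemma measurable_nearest V u w : measurable_fun [set: T] (fun x => c x u w) ->
  (forall v, v \in V -> measurable_fun [set: T] (fun x => c x u v)) ->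
  measurable_fun [set: T] (fun x => nearest (c x) V u w).
Proof.
move=> mw mc; apply: measurable_forall => v.
have [|vV] := boolP (v \in V :\ w); last exact: measurable_cst.
rewrite in_setD1 => /andP[_ vV].
by apply: measurable_fun_ltr => //; exact: mc.
Qed.

Lemma measurable_path_length k V u :
  (forall v, v \in V -> measurable_fun [set: T] (fun x => c x u v)) ->
  (forall v w, v \in V -> w \in V -> v != w ->
    measurable_fun [set: T] (fun x => c x v w)) ->
  measurable_fun [set: T] (fun x => path_length (c x) k V u).
Proof.
elim: k V u => [|k IH] V u mu mV /=; first exact: measurable_cst.
rewrite (_ : (fun _ => _) = (fun x => \sum_w
    (if w \in V then (nearest (c x) V u w)%:R * (c x u w + path_length (c x) k
      (V :\ w) w) else 0))).
  apply: measurable_sum => w; have [wV|_] := boolP (w \in V);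
    last exact: measurable_cst.
  apply: measurable_funM; first by
    apply/measurable_natr_bool/measurable_nearest => //; exact: mu.
  apply: measurable_funD; first exact: mu.
  apply: IH => [v|v v']; rewrite !in_setD1.
    by move=> /andP[vw vV]; apply: mV => //; rewrite eq_sym.
  by move=> /andP[_ vV] /andP[_ v'V]; exact: mV.
by apply/funext => x; rewrite big_mkcond.
Qed.

Lemma measurable_path_end k V u y :
  (forall v, v \in V -> measurable_fun [set: T] (fun x => c x u v)) ->
  (forall v w, v \in V -> w \in V -> v != w ->
    measurable_fun [set: T] (fun x => c x v w)) ->
  measurable_fun [set: T] (fun x => path_end (c x) k V u y).
Proof.
elim: k V u => [|k IH] V u mu mV /=; first exact: measurable_cst.
apply: measurable_exists => w.
have [wV|_] /= := boolP (w \in V); last exact: measurable_cst.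
apply: measurable_and; first by apply: measurable_nearest => //; exact: mu.
apply: IH => [v|v v']; rewrite !in_setD1.
  by move=> /andP[vw vV]; apply: mV => //; rewrite eq_sym.
by move=> /andP[_ vV] /andP[_ v'V]; exact: mV.
Qed.

End measurable_paths.

(** * Independence structure of the edge lengths *)

Section mean_field.
Context (R : realType) d (T : measurableType d) (P : probability T R) (N : nat).
Context (L : 'I_N -> 'I_N -> {RV P >-> R}) (F : probability R R).
Hypothesis mfL : mean_field_distances L F.
Hypothesis F_nonneg : F [set t | t < 0] = 0%E.
Hypothesis F_atomless : forall x, F [set x] = 0%E.
Implicit Types (V W : {set 'I_N}) (u v w : 'I_N) (t : R).

Definition edge_length (e : edge N) : {RV P >-> R} := L (val e).1 (val e).2.

Let indL : mutually_independent edge_length := mfL.2.1.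

(** Truncation makes all lengths nonnegative for every outcome; by [ae_nonneg] it changes them only
    on a null set. *)
Definition cost (x : T) u v : R := pospart (L u v x).

(** These are the edges inspected by a step from u into V, and [inner V] contains those inspected by
    all later steps. Both endpoints are tested because an edge is stored with its smaller city
    first. *)
Definition star u V : {set edge N} :=
  [set e | ((val e).1 == u) && ((val e).2 \in V)
        || ((val e).2 == u) && ((val e).1 \in V)]%SET.

Definition inner V : {set edge N} :=
  [set e | ((val e).1 \in V) && ((val e).2 \in V)]%SET.

Lemma cost_ge0 x u v : 0 <= cost x u v. Proof. exact: pospart_ge0. Qed.

Lemma costC x u v : cost x u v = cost x v u.
Proof. by rewrite /cost mfL.1. Qed.

Lemma measurable_cost u v : measurable_fun [set: T] (fun x => cost x u v).
Proof. by apply: measurableT_comp => //; exact: measurable_pospart. Qed.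

Lemma cost_edge u v : u != v -> exists2 e : edge N,
  forall x, cost x u v = pospart (edge_length e x) &
  val e = (u, v) \/ val e = (v, u).
Proof.
move=> uv; have [uv'|vu|/val_inj/eqP] := ltngtP u v;
  last by rewrite (negbTE uv).
- by exists (exist _ (u, v) uv'); [|left].
- by exists (exist _ (v, u) vu); [move=> x; rewrite costC|right].
Qed.

Lemma measurable_cost_block (J : {set edge N}) u v : u != v ->
  (forall e : edge N, val e = (u, v) \/ val e = (v, u) -> e \in J) ->
  measurable_fun [set: blockT edge_length J] (fun x => cost x u v).
Proof.
move=> uv uvJ; have [e Ee eJ] := cost_edge uv.
rewrite (_ : (fun _ => _) = (@pospart R) \o edge_length e); last first.
  by apply/funext => x; rewrite /= -Ee.
apply: measurableT_comp; first exact: measurable_pospart.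
by apply: measurable_blockT_fun; exact: uvJ.
Qed.

Lemma measurable_cost_star u V v : u \notin V -> v \in V ->
  measurable_fun [set: blockT edge_length (star u V)] (fun x => cost x u v).
Proof.
move=> uV vV; apply: measurable_cost_block.
  by apply: contraNneq uV => ->.
by move=> e; rewrite inE => -[->|->] /=; rewrite eqxx vV ?orbT.
Qed.

Lemma measurable_cost_inner V u v : u != v -> u \in V -> v \in V ->
  measurable_fun [set: blockT edge_length (inner V)] (fun x => cost x u v).
Proof.
move=> uv uV vV; apply: measurable_cost_block => // e.
by rewrite inE => -[->|->] /=; rewrite uV vV.
Qed.

Lemma disjoint_star_inner u V : u \notin V -> [disjoint star u V & inner V]%B.
Proof.
move=> uV; apply/pred0P => e /=; apply/negP; rewrite !inE => /andP[+ /andP[h1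
  h2]].
by case/orP => /andP[/eqP eu _]; move: uV; rewrite -eu ?h1 ?h2.
Qed.

Lemma disjoint_stars u V W : u \notin V -> u \notin W -> [disjoint V & W]%B ->
  [disjoint star u V & star u W]%B.
Proof.
move=> uV uW VW; apply/pred0P => e /=; apply/negP; rewrite !inE => /andP[].
case/orP => /andP[/eqP e1 eV]; case/orP => /andP[/eqP e2 eW].
- by move: eW; rewrite (disjointFr VW eV).
- by move: uV; rewrite -e2 eV.
- by move: uV; rewrite -e2 eV.
- by move: eW; rewrite (disjointFr VW eV).
Qed.

Lemma integral_cost u v (phi : R -> \bar R) : u != v ->
  measurable_fun [set: R] phi -> (forall x, 0 <= phi x)%E ->
  (\int[P]_x phi (cost x u v) = \int[F]_y phi (pospart y))%E.
Proof.
move=> uv mphi phi0; have [e Ee _] := cost_edge uv.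
transitivity (\int[distribution P (edge_length e)]_y phi (pospart y))%E.
  rewrite ge0_integral_distribution//.
    by apply: eq_integral => x _; rewrite Ee.
  by apply: measurableT_comp => //; exact: measurable_pospart.
by apply: eq_measure_integral => A mA _; exact: mfL.2.2.
Qed.

Lemma ptail_cost u v t : u != v ->
  (P [set x | t < cost x u v]%R = ptail F t)%E.
Proof.
move=> uv; rewrite -integral_natr_bool; last first.
  by apply: measurable_fun_ltr; [exact: measurable_cst|exact: measurable_cost].
rewrite (@integral_cost _ _ (fun y => (t < y)%R%:R%:E))//; last first.
  apply/measurable_EFinP; apply: measurable_natr_bool.
  by apply: measurable_fun_ltr => //; exact: measurable_cst.
rewrite integral_natr_bool//.
by apply: measurable_fun_ltr; [exact: measurable_cst|exact: measurable_pospart].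
Qed.

(** Truncation could create an atom at 0, but only out of the negative values, which have mass 0. *)
Lemma cost_atomless u v r : u != v -> (P [set x | cost x u v == r]%R = 0)%E.
Proof.
move=> uv; rewrite -integral_natr_bool; last first.
  by apply: measurable_fun_eqr; [exact: measurable_cost|exact: measurable_cst].
rewrite (@integral_cost _ _ (fun y => (y == r)%R%:R%:E))//; last first.
  apply/measurable_EFinP; apply: measurable_natr_bool.
  by apply: measurable_fun_eqr => //; exact: measurable_cst.
have mb : measurable_fun [set: R] (fun y : R => pospart y == r).
  by apply: measurable_fun_eqr; [exact: measurable_pospart|exact:
    measurable_cst].
rewrite integral_natr_bool//.
apply/eqP; rewrite eq_le measure_ge0 andbT.
have ms : measurable [set t : R | t < 0].
  by rewrite (_ : [set _ | _] = `]-oo, 0[%classic)//; apply/seteqP;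
    split => y /=; rewrite in_itv.
apply: (@le_trans _ _ (F ([set r] `|` [set t | t < 0]))).
  apply: le_measure; rewrite ?inE.
  - exact: measurable_set_bool.
  - exact: measurableU.
  - move=> y /= /eqP; have [y0|y0] := leP 0 y; last by right.
    by rewrite pospart_id// => ->; left.
rewrite (le_trans (measureU2 _ _ _))//.
by rewrite [X in (X + _)%E]F_atomless [X in (_ + X)%E]F_nonneg adde0.
Qed.

Definition nondegenerate (x : T) : Prop :=
  tie_free (cost x) /\ forall u v, u != v -> cost x u v = L u v x.

Lemma decouple_cost (J K : {set edge N})
    (H : blockT edge_length J * blockT edge_length K -> \bar R) :
  [disjoint J & K]%B -> measurable_fun setT H -> (forall z, 0 <= H z)%E ->
  (\int[P]_w H (w, w) = \int[P]_x \int[P]_y H (x, y))%E.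
Proof. exact: (decouple indL). Qed.

(** With the length of uv frozen, the length of uw, which belongs to a disjoint block, hits that
    value with probability 0. *)
Lemma ae_neq_cost u v w : u != v -> u != w -> v != w ->
  {ae P, forall x, cost x u v != cost x u w}.
Proof.
move=> uv uw vw.
exists [set x | cost x u v == cost x u w]; split.
- by apply: measurable_set_bool; apply: measurable_fun_eqr;
  exact: measurable_cost.
- rewrite -integral_natr_bool; last by apply: measurable_fun_eqr;
  exact: measurable_cost.
  pose J := star u [set v]%SET; pose K := star u [set w]%SET.
  have uv1 : u \notin [set v]%SET by rewrite inE.
  have uw1 : u \notin [set w]%SET by rewrite inE.
  have JK : [disjoint J & K]%B by apply: disjoint_stars => //;
    rewrite disjoints1 inE.
  rewrite (@decouple_cost J K (fun z => (cost z.1 u v == cost z.2 u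
    w)%:R%:E))//.
  + rewrite integral0_eq// => x _ /=; rewrite integral_natr_bool; last first.
      by apply: measurable_fun_eqr; [exact: measurable_cst|exact:
        measurable_cost].
    by under eq_set do rewrite eq_sym; rewrite cost_atomless.
  + apply/measurable_EFinP; apply: measurable_natr_bool;
    apply: measurable_fun_eqr.
      apply: (measurableT_comp (measurable_cost_star uv1 _));
        last exact: measurable_fst.
      by rewrite inE.
    apply: (measurableT_comp (measurable_cost_star uw1 _));
      last exact: measurable_snd.
    by rewrite inE.
- by move=> x /= /negP; rewrite negbK.
Qed.

Lemma ae_nonneg u v : u != v -> {ae P, forall x, cost x u v = L u v x}.
Proof.
move=> uv; have [e Ee euv] := cost_edge uv.
have ms : measurable [set t : R | t < 0].
  by rewrite (_ : [set _ | _] = `]-oo, 0[%classic)//; apply/seteqP;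
    split => y /=; rewrite in_itv.
exists (edge_length e @^-1` [set t : R | t < 0]); split.
- by rewrite -[X in measurable X]setTI; exact: measurable_funPT.
- by rewrite -[LHS]/(distribution P (edge_length e) _) mfL.2.2.
- move=> x /= h; rewrite ltNge; apply/negP => e0; apply: h.
  rewrite Ee pospart_id// /edge_length.
  by case: euv => ->//=; rewrite mfL.1.
Qed.

Lemma ae_nondegenerate : {ae P, forall x, nondegenerate x}.
Proof.
have h1 : {ae P, forall x, tie_free (cost x)}.
  rewrite /tie_free; apply: filter_forall => u; apply: filter_forall => v.
  apply: filter_forall => w.
  have [uv|_] := boolP (u != v); last by apply: filterE.
  have [uw|_] := boolP (u != w); last by apply: filterE.
  have [vw|_] := boolP (v != w); last by apply: filterE.
  by apply: filterS (ae_neq_cost uv uw vw) => x h _ _ _.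
have h2 : {ae P, forall x, forall u v, u != v -> cost x u v = L u v x}.
  apply: filter_forall => u; apply: filter_forall => v.
  have [uv|_] := boolP (u != v); last by apply: filterE.
  by apply: filterS (ae_nonneg uv) => x h _.
by apply: filterS2 h1 h2 => x.
Qed.

End mean_field.

Section indicators.
Context d (T : measurableType d) (R : realType) (P : probability T R).

Definition indb (b : bool) : \bar R := b%:R%:E.

Lemma indb_ge0 b : (0 <= indb b)%E. Proof. by rewrite lee_fin. Qed.

Lemma indb_and b c : (indb (b && c) = indb b * indb c)%E.
Proof. by case: b; case: c; rewrite /indb/= -EFinM ?mul1r ?mul0r. Qed.

Lemma measurable_indb (b : T -> bool) : measurable_fun [set: T] b ->
  measurable_fun [set: T] (fun x => indb (b x)).
Proof. by move=> mb; apply/measurable_EFinP; exact: measurable_natr_bool. Qed.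

Lemma integral_law (m : probability R R) (X : T -> R) (phi : R -> \bar R) :
  measurable_fun [set: T] X -> (forall x, 0 <= X x) ->
  (forall t, \int[P]_x indb (t < X x)%R = ptail m t)%E ->
  measurable_fun [set: R] phi -> (forall y, 0 <= phi y)%E ->
  (\int[P]_x phi (X x) = \int[m]_y phi (pospart y))%E.
Proof.
move=> mX X0 HX mphi phi0; pose X' : {RV P >-> R} := mfun_Sub (mem_set mX).
transitivity (\int[distribution P X']_y phi y)%E.
  by rewrite ge0_integral_distribution.
transitivity (\int[distribution m (@pospart R : {RV m >-> R})]_y phi y)%E;
  last first.
  by rewrite ge0_integral_distribution.
apply: eq_measure_integral => A mA _; apply: eq_distribution_tail => // t.
rewrite -ptailE -HX integral_natr_bool; last by apply: measurable_fun_ltr.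
rewrite /ccdf /distribution/pushforward/=; congr (P _).
by apply/seteqP; split => x /=; rewrite in_itv/= andbT.
Qed.

End indicators.

Lemma nearest_forall (R : realType) N (c : 'I_N -> 'I_N -> R) (V : {set 'I_N})
  u w r :
  w \in V -> nearest c V u w -> [forall (v | v \in V), r < c u v] = (r < c u w).
Proof.
move=> wV /forallP nw; apply/forallP/idP => [/(_ w)|rw v]; first by rewrite wV.
apply/implyP => vV; have [->//|vw] := eqVneq v w.
by have := nw v; rewrite in_setD1 vw vV /=; exact: lt_trans.
Qed.

Section path_distribution.
Context (R : realType) d (T : measurableType d) (P : probability T R) (N : nat).
Context (L : 'I_N -> 'I_N -> {RV P >-> R}) (F : probability R R).
Hypothesis mfL : mean_field_distances L F.
Hypothesis F_nonneg : F [set t | t < 0] = 0%E.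
Hypothesis F_atomless : forall x, F [set x] = 0%E.
Implicit Types (V W : {set 'I_N}) (u v w : 'I_N) (t : R).

Local Notation cost := (cost L).
Local Notation blockE := (blockT (edge_length L)).

Local Notation ind := (@indb R).

Lemma decouple_mul (J K : {set edge N}) (f : blockE J -> \bar R) (g : blockE K
  -> \bar R) :
  [disjoint J & K]%B -> measurable_fun setT f -> measurable_fun setT g ->
  (forall x, 0 <= f x)%E -> (forall x, 0 <= g x)%E ->
  (\int[P]_x (f x * g x) = (\int[P]_x f x) * (\int[P]_x g x))%E.
Proof.
move=> JK mf mg f0 g0.
rewrite (decouple_cost mfL (H := fun z : blockE J * blockE K => f z.1 * g
  z.2)%E JK).
- have mfT : measurable_fun [set: T] f.
    exact: (measurableT_comp mf (@measurable_to_block _ _ _ _ _ (edge_length L)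
      J)).
  have mgT : measurable_fun [set: T] g.
    exact: (measurableT_comp mg (@measurable_to_block _ _ _ _ _ (edge_length L)
      K)).
  transitivity (\int[P]_x (f x * \int[P]_y g y))%E.
    by apply: eq_integral => x _ /=; rewrite ge0_integralZl.
  by rewrite ge0_integralZr// integral_ge0.
- by apply: emeasurable_funM; apply: measurableT_comp.
- by move=> z; rewrite mule_ge0.
Qed.

Lemma measurable_star_forall V W u t : u \notin V -> W \subset V ->
  measurable_fun [set: blockE (star u V)]
    (fun x => [forall (v | v \in W), t < cost x u v]).
Proof.
move=> uV /fintype.subsetP WV; apply: measurable_forall => v.
have [vW|_] := boolP (v \in W); last exact: measurable_cst.
apply: measurable_fun_ltr; first exact: measurable_cst.
exact: (measurable_cost_star mfL uV (WV _ vW)).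
Qed.

Lemma ptail_star V u t : u \notin V ->
  (\int[P]_x ind [forall (v | v \in V), t < cost x u v]%R = ptail F t ^+
    #|V|)%E.
Proof.
move=> uV; move cV : #|V| => k; elim: k V uV cV => [|k IH] V uV cV.
  rewrite expe0 -[RHS](probability_setT P) -[RHS]mul1e -integral_cst//.
  apply: eq_integral => x _; suff -> : [forall v in V, t < cost x u v] by [].
  by apply/forallP => v; rewrite (cards0_eq cV) inE.
have [w wV] : exists w, w \in V by apply/set0Pn; rewrite -card_gt0 cV.
pose W := V :\ w.
have uw : u != w by apply: contraNneq uV => ->.
have uW : u \notin W by rewrite in_setD1 negb_and uV orbT.
have cW : #|W| = k by have := cardsD1 w V; rewrite wV cV => -[].
have u1 : u \notin [set w]%SET by rewrite inE.
have JK : [disjoint star u [set w]%SET & star u W]%B.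
  by apply: disjoint_stars => //; rewrite disjoints1 !inE eqxx.
transitivity (\int[P]_x (ind (t < cost x u w)%R * ind [forall (v | v \in W), t
  < cost x u v]%R))%E.
  apply: eq_integral => x _; rewrite -indb_and; congr (ind _).
  apply/forallP/andP => [h|[tw /forallP h] v].
    split; first by have := h w; rewrite wV.
    by apply/forallP => v; apply/implyP; rewrite in_setD1 => /andP[_ vV];
      have := h v; rewrite vV.
  apply/implyP => vV; have [->//|vw] := eqVneq v w.
  by have := h v; rewrite in_setD1 vw vV.
rewrite (decouple_mul JK); last first.
- by move=> x; exact: indb_ge0.
- by move=> x; exact: indb_ge0.
- by apply: measurable_indb; apply: measurable_star_forall.
- apply: measurable_indb; apply: measurable_fun_ltr;
  first exact: measurable_cst.
  by apply: (measurable_cost_star mfL) => //; rewrite inE.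
rewrite IH// integral_natr_bool; last first.
  by apply: measurable_fun_ltr; [exact: measurable_cst|exact: measurable_cost].
by rewrite (ptail_cost mfL)// expeS.
Qed.

(** Total probability for events that partition the space only almost surely; in the applications
    the exceptional set is the one where [nondegenerate] fails. *)
Lemma integral_partition (I : finType) (S : {set I}) (E : I -> T -> bool)
    (f : T -> \bar R) :
  (forall i, i \in S -> measurable_fun [set: T] (E i)) ->
  measurable_fun [set: T] f -> (forall x, 0 <= f x)%E ->
  {ae P, forall x, \sum_(i in S) (E i x)%:R = 1 :> R} ->
  (\int[P]_x f x = \sum_(i in S) \int[P]_x (ind (E i x) * f x))%E.
Proof.
move=> mE mf f0 E1.
transitivity (\int[P]_x \sum_(i <- enum S) (ind ((i \in S) && E i x) * f x))%E.
  apply: ge0_ae_eq_integral => //.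
  - apply: emeasurable_sum => i; apply: emeasurable_funM => //;
    apply: measurable_indb.
    by have [iS|_] /= := boolP (i \in S); [exact: mE|exact: measurable_cst].
  - by move=> x _; apply: sume_ge0 => i _; rewrite mule_ge0// indb_ge0.
  - apply: filterS E1 => x E1 _.
    rewrite -ge0_sume_distrl; last by move=> i _; exact: indb_ge0.
    rewrite big_enum/= (eq_bigr (fun i => (E i x)%:R%:E)); last by move=> i ->.
    by rewrite sumEFin E1 mul1e.
rewrite ge0_integral_sum//; last 2 first.
- move=> i; apply: emeasurable_funM => //; apply: measurable_indb.
  by have [iS|_] /= := boolP (i \in S); [exact: mE|exact: measurable_cst].
- by move=> i x _; rewrite mule_ge0// indb_ge0.
rewrite big_enum/=; apply: eq_bigr => i iS.
by apply: eq_integral => x _; rewrite iS.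
Qed.

Lemma measurable_nearest_star V u w : u \notin V -> w \in V ->
  measurable_fun [set: blockE (star u V)] (fun x => nearest (cost x) V u w).
Proof.
move=> uV wV; apply: measurable_nearest => [|v vV];
  exact: (measurable_cost_star mfL).
Qed.

Lemma measurable_path_length_inner k V w : w \in V ->
  measurable_fun [set: blockE (inner V)] (fun x => path_length (cost x) k (V :\
    w) w).
Proof.
move=> wV; apply: measurable_path_length => [v|v v'].
  by rewrite in_setD1 eq_sym => /andP[vw vV];
    exact: (measurable_cost_inner mfL).
rewrite !in_setD1 => /andP[_ vV] /andP[_ v'V] vv'.
exact: (measurable_cost_inner mfL).
Qed.

Lemma measurable_path_end_inner k V w y : w \in V ->
  measurable_fun [set: blockE (inner V)] (fun x => path_end (cost x) k (V :\ w)
    w y).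
Proof.
move=> wV; apply: measurable_path_end => [v|v v'].
  by rewrite in_setD1 eq_sym => /andP[vw vV];
    exact: (measurable_cost_inner mfL).
rewrite !in_setD1 => /andP[_ vV] /andP[_ v'V] vv'.
exact: (measurable_cost_inner mfL).
Qed.

Lemma integral_nearest V u (f : T -> \bar R) : u \notin V -> V != finset.set0 ->
  measurable_fun [set: T] f -> (forall x, 0 <= f x)%E ->
  (\int[P]_x f x = \sum_(w in V) \int[P]_x (ind (nearest (cost x) V u w) * f
    x))%E.
Proof.
move=> uV V0 mf f0; apply: integral_partition => //.
  by move=> w wV; apply: measurable_nearest => [|v _]; exact: measurable_cost.
apply: filterS (ae_nondegenerate mfL F_nonneg F_atomless) => x [tf _].
exact: sum_nearest1.
Qed.

(** The outcomes are split by the first neighbour w. The path from w uses [inner V], while the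
    choice of w and the length of uw use [star u V]. With the rest of the path frozen at length s,
    the events that w is nearest and uw exceeds t - s add up over w to the event that every edge
    from u to V exceeds t - s. *)
Lemma path_length_law k V u t : u \notin V -> #|V| = k ->
  (\int[P]_x ind (t < path_length (cost x) k V u)%R = ptail (pathlaw F k) t)%E.
Proof.
elim: k V u t => [|k IH] V u t uV cV.
  rewrite /= /ptail /= diracE; have [t0|t0] := ltP t 0.
    rewrite mem_set/=; last by rewrite /pospart maxxx.
    by rewrite -(probability_setT P) -[RHS]mul1e -integral_cst.
  rewrite memNset/=; last by rewrite /pospart maxxx => /lt_geF; rewrite t0.
  by rewrite integral0_eq.
have V0 : V != finset.set0 by rewrite -card_gt0 cV.
have mpl j W w : measurable_fun [set: T] (fun x => path_length (cost x) j W w).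
  by apply: measurable_path_length => [v _|v v' _ _ _]; exact: measurable_cost.
have mnear w : measurable_fun [set: T] (fun x => nearest (cost x) V u w).
  by apply: measurable_nearest => [|v _]; exact: measurable_cost.
rewrite (integral_nearest uV V0); last 2 first.
- by apply: measurable_indb; apply: measurable_fun_ltr;
  [exact: measurable_cst|exact: mpl].
- by move=> x; exact: indb_ge0.
pose g w (z : R * T) : \bar R :=
  (ind (nearest (cost z.2) V u w) * ind (t - z.1 < cost z.2 u w)%R)%E.
have mg w : measurable_fun [set: R * T] (g w).
  apply: emeasurable_funM; apply: measurable_indb.
    by apply: (measurableT_comp (mnear w)); exact: measurable_snd.
  apply: measurable_fun_ltr.
    by apply: measurable_funB; [exact: measurable_cst|exact: measurable_fst].
  by apply: (measurableT_comp (measurable_cost L u w)); exact: measurable_snd.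
have g0 w z : (0 <= g w z)%E by rewrite mule_ge0// indb_ge0.
pose phi w s := (\int[P]_x g w (s, x))%E.
have mphi w : measurable_fun [set: R] (phi w).
  exact: (@measurable_fun_fubini_tonelli_F _ _ _ _ _ P _ (mg w) (g0 w)).
have phi0 w s : (0 <= phi w s)%E by apply: integral_ge0 => x _; exact: g0.
have step w : w \in V ->
    (\int[P]_x (ind (nearest (cost x) V u w) * ind (t < path_length (cost x)
      k.+1 V u)%R)
     = \int[pathlaw F k]_s phi w (pospart s))%E.
  move=> wV.
  have JK : [disjoint inner V & star u V]%B.
    by rewrite disjoint_sym; exact: disjoint_star_inner.
  transitivity (\int[P]_y phi w (path_length (cost y) k (V :\ w) w))%E.
    rewrite -(decouple_cost mfL (H := fun z : blockE (inner V) * blockE (star u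
      V) =>
      g w (path_length (cost z.1) k (V :\ w) w, z.2)) JK).
    - apply: eq_integral => x _; rewrite /g /=.
      have [nw|_] := boolP (nearest (cost x) V u w); last by rewrite !mul0e.
      by rewrite -/(path_length _ k.+1 _ _) (path_lengthS _ wV nw) ltrBlDr.
    - apply: emeasurable_funM; apply: measurable_indb.
        by apply: (measurableT_comp (measurable_nearest_star uV wV));
          exact: measurable_snd.
      apply: measurable_fun_ltr.
        apply: measurable_funB; first exact: measurable_cst.
        by apply: (measurableT_comp (measurable_path_length_inner k wV));
          exact: measurable_fst.
      by apply: (measurableT_comp (measurable_cost_star mfL uV wV));
        exact: measurable_snd.
    - by move=> z; exact: g0.
  apply: (integral_law (mpl _ _ _)) => //.
  - by move=> x; apply: path_length_ge0 => i j; exact: cost_ge0.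
  - move=> s; apply: IH; first by rewrite in_setD1 eqxx.
    by have := cardsD1 w V; rewrite wV cV => -[].
rewrite (eq_bigr _ step).
(* By induction the rest of the path has the same law whatever w is, so the sum over w moves under
   one integral. *)
rewrite [RHS]ptail_addp -big_enum/= -ge0_integral_sum//=; last first.
  by move=> w; apply: (measurableT_comp (mphi w)); exact: measurable_pospart.
apply: eq_integral => s _; rewrite ptail_minlaw -cV -(ptail_star _ uV).
have mfa r : measurable_fun [set: T] (fun x => [forall (v | v \in V), r < cost
  x u v]).
  apply: measurable_forall => v; have [_|_] := boolP (v \in V);
    last exact: measurable_cst.
  by apply: measurable_fun_ltr; [exact: measurable_cst|exact: measurable_cost].
rewrite [RHS](integral_nearest uV V0); last 2 first.
- exact: measurable_indb.
- by move=> x; exact: indb_ge0.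
rewrite big_enum/=; apply: eq_bigr => w wV; apply: eq_integral => x _.
rewrite /g/=; have [nw|_] := boolP (nearest (cost x) V u w);
  last by rewrite !mul0e.
by rewrite (nearest_forall _ wV nw).
Qed.

End path_distribution.

(** * The last edge of the tour *)

Lemma nearest_setD1 (R : realType) N (c : 'I_N -> 'I_N -> R) (V : {set 'I_N}) u
  w y :
  y \in V -> w != y ->
  nearest c V u w = nearest c (V :\ y) u w && (c u w < c u y).
Proof.
move=> yV wy; apply/forallP/andP => [h|[/forallP h hy] v].
  split; last by have := h y; rewrite in_setD1 yV eq_sym wy.
  apply/forallP => v; apply/implyP; rewrite !in_setD1 => /and3P[vw _ vV].
  by have := h v; rewrite in_setD1 vw vV.
apply/implyP; rewrite in_setD1 => /andP[vw vV]; have [->//|vy] := eqVneq v y.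
by have := h v; rewrite !in_setD1 vw vy vV.
Qed.

Section tour_distribution.
Context (R : realType) d (T : measurableType d) (P : probability T R) (N : nat).
Context (L : 'I_N -> 'I_N -> {RV P >-> R}) (F : probability R R).
Hypothesis mfL : mean_field_distances L F.
Hypothesis F_nonneg : F [set t | t < 0] = 0%E.
Hypothesis F_atomless : forall x, F [set x] = 0%E.
Implicit Types (V W : {set 'I_N}) (u v w y : 'I_N) (t r : R).

Local Notation cost := (cost L).
Local Notation blockE := (blockT (edge_length L)).
Local Notation ind := (@indb R).

Definition last_edge k V u (x : T) : R :=
  \sum_(y in V) (path_end (cost x) k V u y)%:R * cost x u y.

Lemma measurable_nearest_cost V u w :
  measurable_fun [set: T] (fun x => nearest (cost x) V u w).
Proof. by apply: measurable_nearest => [|v _]; exact: measurable_cost. Qed.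

Lemma measurable_path_length_cost k V u :
  measurable_fun [set: T] (fun x => path_length (cost x) k V u).
Proof.
by apply: measurable_path_length => [v _|v v' _ _ _]; exact: measurable_cost.
Qed.

Lemma measurable_path_end_cost k V u y :
  measurable_fun [set: T] (fun x => path_end (cost x) k V u y).
Proof.
by apply: measurable_path_end => [v _|v v' _ _ _]; exact: measurable_cost.
Qed.

Lemma measurable_last_edge k V u : measurable_fun [set: T] (last_edge k V u).
Proof.
rewrite (_ : last_edge k V u = (fun x => \sum_y (if y \in V then
    (path_end (cost x) k V u y)%:R * cost x u y else 0))).
  apply: measurable_sum => y; have [_|_] := boolP (y \in V);
    last exact: measurable_cst.
  apply: measurable_funM; last exact: measurable_cost.
  exact/measurable_natr_bool/measurable_path_end_cost.
by apply/funext => x; rewrite /last_edge big_mkcond.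
Qed.

Lemma last_edge_ge0 k V u x : 0 <= last_edge k V u x.
Proof. by apply: sumr_ge0 => y _; rewrite mulr_ge0// cost_ge0. Qed.

(* Conditioning on the length of uw expresses the probability by an integral
   that does not depend on w, and these probabilities add up to 1 over V. *)
Lemma nearest_probability V u w : u \notin V -> w \in V ->
  (\int[P]_x ind (nearest (cost x) V u w) = (#|V|%:R^-1)%:E)%E.
Proof.
move=> uV wV; have V0 : V != finset.set0 by apply/set0Pn; exists w.
pose k := #|V|.-1; have kE : #|V| = k.+1 by rewrite prednK// card_gt0.
pose K := (\int[F]_s (ptail F (pospart s) ^+ k))%E.
have mK : measurable_fun [set: R] (fun s => ptail F s ^+ k)%E.
  case: (k) => [|k']; first exact: measurable_cst.
  apply: (eq_measurable_fun (ptail (minlaw F k')));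
    last exact: measurable_ptail.
  by move=> t _; rewrite ptail_minlaw.
have nK v : v \in V -> (\int[P]_x ind (nearest (cost x) V u v) = K)%E.
  move=> vV; have uv : u != v by apply: contraNneq uV => ->.
  have u1 : u \notin [set v]%SET by rewrite inE.
  have uW : u \notin V :\ v by rewrite in_setD1 negb_and uV orbT.
  have JK : [disjoint star u [set v]%SET & star u (V :\ v)]%B.
    by apply: disjoint_stars => //; rewrite disjoints1 !inE eqxx.
  rewrite (decouple_cost mfL (H := fun z : blockE _ * blockE _ =>
    ind [forall (w' | w' \in V :\ v), cost z.1 u v < cost z.2 u w']) JK).
  - have K0 s : (0 <= ptail F s ^+ k)%E by rewrite expe_ge0// ptail_ge0.
    apply: etrans (integral_cost mfL uv mK K0).
    apply: eq_integral => x _ /=; rewrite (ptail_star mfL)//.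
    by have := cardsD1 v V; rewrite vV kE add1n => -[->].
  - apply: measurable_indb; apply: measurable_forall => w'.
    have [wW|_] /= := boolP (w' \in V :\ v); last exact: measurable_cst.
    apply: measurable_fun_ltr.
      apply: (measurableT_comp (measurable_cost_star mfL u1 _));
        last exact: measurable_fst.
      by rewrite inE.
    by apply: (measurableT_comp (measurable_cost_star mfL uW wW));
      exact: measurable_snd.
  - by move=> z; exact: indb_ge0.
have : (\int[P]_x (cst 1 x) = 1)%E by rewrite integral_cst//= probability_setT
  mule1.
rewrite (integral_nearest mfL F_nonneg F_atomless uV V0)//.
rewrite (eq_bigr (fun=> K)); last first.
  by move=> v vV; rewrite -(nK v vV); apply: eq_integral => x _; rewrite mule1.
have K1 : (0 <= K <= 1)%E.
  rewrite -(nK w wV) integral_ge0/=; last by move=> x _; exact: indb_ge0.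
  rewrite integral_natr_bool; last exact: measurable_nearest_cost.
  by apply: probability_le1; apply/measurable_set_bool/measurable_nearest_cost.
have : K \is a fin_num.
  by case/andP: K1 => K0 K1; rewrite ge0_fin_numE// (le_lt_trans K1)// ltry.
rewrite nK//; case: K {nK mK K1} => [r| |]// _.
rewrite sumEFin sumr_const => -[rV]; congr (_%:E).
have Vn0 : #|V|%:R != 0 :> R by rewrite kE pnatr_eq0.
by apply: (mulIf Vn0); rewrite mulVf// mulr_natr.
Qed.

Lemma sum_indb_nearest V u : u \notin V -> V != finset.set0 ->
  (\sum_(w in V) \int[P]_x ind (nearest (cost x) V u w) = 1)%E.
Proof.
move=> uV V0.
have <- : (\int[P]_x (cst 1 x) = 1)%E by rewrite integral_cst//=
  probability_setT mule1.
rewrite (integral_nearest mfL F_nonneg F_atomless uV V0)//.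
by apply: eq_bigr => w _; apply: eq_integral => x _; rewrite mule1.
Qed.

(** With the other edges at u frozen and w nearest among the cities other than y, the two events
    together say that uy exceeds both uw and r. *)
Lemma nearest_edge_ptail V u w y r : u \notin V -> w \in V -> y \in V -> w != y
  ->
  (\int[P]_x (ind (nearest (cost x) V u w) * ind (r < cost x u y)%R) =
   \int[P]_x (ind (nearest (cost x) (V :\ y) u w)
               * ptail F (Num.max (cost x u w) r)))%E.
Proof.
move=> uV wV yV wy.
have uy : u != y by apply: contraNneq uV => ->.
have u1 : u \notin [set y]%SET by rewrite inE.
have uW : u \notin V :\ y by rewrite in_setD1 negb_and uV orbT.
have wW : w \in V :\ y by rewrite in_setD1 wy.
have JK : [disjoint star u (V :\ y) & star u [set y]%SET]%B.
  by apply: disjoint_stars => //; rewrite disjoint_sym disjoints1 !inE eqxx.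
transitivity (\int[P]_x (ind (nearest (cost x) (V :\ y) u w)
    * ind (Num.max (cost x u w) r < cost x u y)%R))%E.
  apply: eq_integral => x _; rewrite (nearest_setD1 _ _ yV wy) -!indb_and.
  by rewrite [Num.max (cost x u w) r < _]gt_max andbA.
rewrite (decouple_cost mfL (H := fun z : blockE _ * blockE _ =>
    ind (nearest (cost z.1) (V :\ y) u w)
    * ind (Num.max (cost z.1 u w) r < cost z.2 u y)%R)%E JK).
- apply: eq_integral => x _ /=.
  have mb : measurable_fun [set: T] (fun z => Num.max (cost x u w) r < cost z u
    y).
    by apply: measurable_fun_ltr; [exact: measurable_cst|exact:
      measurable_cost].
  rewrite (ge0_integralZl P measurableT (measurable_indb mb) (fun _ _ =>
    indb_ge0 _ _)
    (indb_ge0 _ _)).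
  by rewrite integral_natr_bool// (ptail_cost mfL).
- apply: emeasurable_funM; apply: measurable_indb.
    by apply: (measurableT_comp (measurable_nearest_star mfL uW wW));
      exact: measurable_fst.
  apply: measurable_fun_ltr.
    apply: measurable_maxr; last exact: measurable_cst.
    by apply: (measurableT_comp (measurable_cost_star mfL uW wW));
      exact: measurable_fst.
  apply: (measurableT_comp (measurable_cost_star mfL u1 _));
    last exact: measurable_snd.
  by rewrite inE.
- by move=> z; rewrite mule_ge0// indb_ge0.
Qed.

(* Given the other edges at u, both events are upper tails of the length of uy,
   hence they are positively correlated. *)
Lemma nearest_edge_ge V u w y r : u \notin V -> w \in V -> y \in V -> w != y ->
  ((\int[P]_x ind (nearest (cost x) V u w)) * ptail F r <=
   \int[P]_x (ind (nearest (cost x) V u w) * ind (r < cost x u y)%R))%E.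
Proof.
move=> uV wV yV wy; rewrite (nearest_edge_ptail r uV wV yV wy).
have -> : (\int[P]_x ind (nearest (cost x) V u w) =
    \int[P]_x (ind (nearest (cost x) (V :\ y) u w) * ptail F (cost x u w)))%E.
  (* Lengths are nonnegative, so the threshold -1 adds a certain event and the same formula
     evaluates the bare probability. *)
  transitivity (\int[P]_x (ind (nearest (cost x) V u w) * ind (-1 < cost x u
    y)%R))%E.
    apply: eq_integral => x _; rewrite (_ : (-1 < cost x u y) = true) ?mule1//.
    by apply: lt_le_trans (cost_ge0 _ _ _ _).
  rewrite (nearest_edge_ptail _ uV wV yV wy); apply: eq_integral => x _.
  by rewrite max_l// (le_trans _ (cost_ge0 _ _ _ _)).
have mt (g : T -> R) : measurable_fun [set: T] g ->
    measurable_fun [set: T] (fun x => ind (nearest (cost x) (V :\ y) u w) *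
      ptail F (g x))%E.
  move=> mg; apply: emeasurable_funM; first
    exact/measurable_indb/measurable_nearest_cost.
  by apply: measurableT_comp => //; exact: measurable_ptail.
have mc := measurable_cost L u w.
rewrite -(ge0_integralZr P measurableT (mt _ mc)); last 2 first.
- by move=> x _; rewrite mule_ge0 ?indb_ge0 ?ptail_ge0.
- exact: ptail_ge0.
apply: ge0_le_integral => //.
- by move=> x _; rewrite !mule_ge0 ?indb_ge0 ?ptail_ge0.
- by apply: emeasurable_funM; [exact: mt|exact: measurable_cst].
- by apply: mt; apply: measurable_maxr => //; exact: measurable_cst.
- move=> x _; rewrite -muleA; apply: lee_pmul => //.
  + exact: indb_ge0.
  + by rewrite mule_ge0 ?ptail_ge0.
  (* The tail at the larger of two points is the smaller of the two tails, hence at least their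
     product, both being at most 1. *)
  + have [_|_] := leP (cost x u w) r.
      by rewrite -[leRHS]mul1e lee_pmul ?ptail_ge0 ?ptail_le1.
    by rewrite -[leRHS]mule1 lee_pmul ?ptail_ge0 ?ptail_le1.
Qed.

(** Removing y from the competition enlarges the event that w is nearest and makes it independent of
    uy. The price is a probability 1 / (|V| - 1) in place of 1 / |V|. *)
Lemma nearest_edge_mean V u w y : u \notin V -> w \in V -> y \in V -> w != y ->
  (\int[P]_x (ind (nearest (cost x) V u w) * (cost x u y)%:E) <=
   (#|V|.-1%:R^-1)%:E * pmean F)%E.
Proof.
move=> uV wV yV wy.
have uy : u != y by apply: contraNneq uV => ->.
have u1 : u \notin [set y]%SET by rewrite inE.
have uW : u \notin V :\ y by rewrite in_setD1 negb_and uV orbT.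
have wW : w \in V :\ y by rewrite in_setD1 wy.
have cW : #|V :\ y| = #|V|.-1 by have := cardsD1 y V; rewrite yV => ->.
have JK : [disjoint star u (V :\ y) & star u [set y]%SET]%B.
  by apply: disjoint_stars => //; rewrite disjoint_sym disjoints1 !inE eqxx.
have mcE : measurable_fun [set: T] (fun x => (cost x u y)%:E).
  by apply/measurable_EFinP; exact: measurable_cost.
apply: (@le_trans _ _ (\int[P]_x (ind (nearest (cost x) (V :\ y) u w) * (cost x
  u y)%:E))%E).
  apply: ge0_le_integral => //.
  - by move=> x _; rewrite mule_ge0 ?indb_ge0 ?lee_fin ?cost_ge0.
  - by apply: emeasurable_funM => //;
    apply/measurable_indb/measurable_nearest_cost.
  - by apply: emeasurable_funM => //;
    apply/measurable_indb/measurable_nearest_cost.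
  - move=> x _; apply: lee_pmul => //; rewrite ?indb_ge0 ?lee_fin ?cost_ge0//.
    by rewrite (nearest_setD1 _ _ yV wy); case: (nearest _ _ _ _) => //=;
      case: (_ < _).
rewrite (decouple_mul mfL JK (f := fun x => ind (nearest (cost x) (V :\ y) u w))
  (g := fun x => (cost x u y)%:E)); last 4 first.
- by apply: measurable_indb; exact: (measurable_nearest_star mfL).
- apply/measurable_EFinP; apply: (measurable_cost_star mfL u1).
  by rewrite inE.
- by move=> x; exact: indb_ge0.
- by move=> x; rewrite lee_fin cost_ge0.
rewrite nearest_probability// cW.
have -> : (\int[P]_x (cost x u y)%:E = pmean F)%E; last by [].
have mp : measurable_fun [set: R] (fun s : R => (pospart s)%:E).
  by apply/measurable_EFinP; exact: measurable_pospart.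
have p0 (s : R) : (0 <= (pospart s)%:E)%E by rewrite lee_fin pospart_ge0.
transitivity (\int[P]_x (pospart (cost x u y))%:E)%E.
  by apply: eq_integral => x _; rewrite pospart_id// cost_ge0.
rewrite (integral_cost mfL uy mp p0); apply: eq_integral => s _.
by rewrite pospart_id// pospart_ge0.
Qed.

Lemma ae_path_end k V w : w \in V -> #|V| = k.+2 ->
  {ae P, forall x, \sum_(y in V :\ w) (path_end (cost x) k.+1 (V :\ w) w y)%:R
    = 1 :> R}.
Proof.
move=> wV cV; apply: filterS (ae_nondegenerate mfL F_nonneg F_atomless) => x
  [tf _].
have cVw : #|V :\ w| = k.+1 by have := cardsD1 w V; rewrite wV cV add1n => -[].
have wVw : w \notin V :\ w by rewrite !inE eqxx.
have [y _ E] := sum_path_end (fun=> 1) tf wVw cVw.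
by apply: etrans E; apply: eq_bigr => z _; rewrite mulr1.
Qed.

Lemma last_edge_ge k V u y x : y \in V -> path_end (cost x) k V u y ->
  cost x u y <= last_edge k V u x.
Proof.
move=> yV e; rewrite /last_edge (bigD1 y)//= e mul1r lerDl.
by apply: sumr_ge0 => z _; rewrite mulr_ge0// cost_ge0.
Qed.

(** The outcomes are split by the first neighbour w and the end y. With the edges inside V frozen,
    [nearest_edge_ge] lets the closing edge be replaced by an independent copy of [F]. The path law
    has index k + 1, not k + 2, because the first edge is discarded. *)
Lemma tour_tail k V u t : u \notin V -> #|V| = k.+2 ->
  (ptail (tourlaw F k.+1) t <=
   \int[P]_x ind (t < path_length (cost x) k.+2 V u + last_edge k.+2 V u
     x)%R)%E.
Proof.
move=> uV cV; have V0 : V != finset.set0 by rewrite -card_gt0 cV.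
have mT : measurable_fun [set: T]
    (fun x => ind (t < path_length (cost x) k.+2 V u + last_edge k.+2 V u x)).
  apply: measurable_indb; apply: measurable_fun_ltr;
    first exact: measurable_cst.
  by apply: measurable_funD;
    [exact: measurable_path_length_cost|exact: measurable_last_edge].
rewrite (integral_nearest mfL F_nonneg F_atomless uV V0 mT); last first.
  by move=> x; exact: indb_ge0.
rewrite -[leLHS]mul1e -(sum_indb_nearest uV V0) ge0_sume_distrl; last first.
  by move=> w _; apply: integral_ge0 => x _; exact: indb_ge0.
apply: lee_sum => w wV.
have JK : [disjoint inner V & star u V]%B.
  by rewrite disjoint_sym; exact: disjoint_star_inner.
have wVw : w \notin V :\ w by rewrite in_setD1 eqxx.
have cVw : #|V :\ w| = k.+1 by have := cardsD1 w V; rewrite wV cV add1n => -[].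
set p := (\int[P]_x ind (nearest (cost x) V u w))%E.
have p0 : (0 <= p)%E by apply: integral_ge0 => x _; exact: indb_ge0.
pose W x := path_length (cost x) k.+1 (V :\ w) w.
have mW : measurable_fun [set: T] W by exact: measurable_path_length_cost.
have W0 x : 0 <= W x by apply: path_length_ge0 => i j; exact: cost_ge0.
have mtW : measurable_fun [set: T] (fun x => ptail F (t - W x)).
  apply: (measurableT_comp (measurable_ptail F)).
  by apply: measurable_funB => //; exact: measurable_cst.
have -> : (ptail (tourlaw F k.+1) t = \int[P]_x ptail F (t - W x))%E.
  rewrite [LHS]ptail_addp.
  apply/esym/(integral_law (P := P) (phi := fun s => ptail F (t - s)) mW W0).
  - move=> s; exact: (path_length_law mfL F_nonneg F_atomless).
  - apply: (measurableT_comp (measurable_ptail F)).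
    by apply: measurable_funB => //; exact: measurable_cst.
  - by move=> s; exact: ptail_ge0.
have mE y : measurable_fun [set: T] (fun x => path_end (cost x) k.+1 (V :\ w) w
  y).
  exact: measurable_path_end_cost.
have mE_ y : y \in V :\ w -> measurable_fun [set: T] (fun x => path_end (cost
  x) k.+1 (V :\ w) w y).
  by move=> _.
rewrite (integral_partition mE_ mtW (fun _ => ptail_ge0 _ _) (ae_path_end wV
  cV)).
have mnT : measurable_fun [set: T] (fun x => ind (nearest (cost x) V u w) *
    ind (t < path_length (cost x) k.+2 V u + last_edge k.+2 V u x)%R)%E.
  apply: emeasurable_funM => //.
  exact/measurable_indb/measurable_nearest_cost.
rewrite (integral_partition mE_ mnT _ (ae_path_end wV cV)); last first.
  by move=> x; rewrite mule_ge0// indb_ge0.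
rewrite muleC ge0_sume_distrl; last first.
  by move=> y _; apply: integral_ge0 => x _; rewrite mule_ge0// ?indb_ge0//
    ptail_ge0.
apply: lee_sum => y; rewrite in_setD1 => /andP[yw yV].
have wy : w != y by rewrite eq_sym.
(* The path from w and the closing edge uy alone are required to exceed t; the omitted first edge
   can only add length, so [h] is a lower bound. *)
pose h (z : blockE (inner V) * blockE (star u V)) : \bar R :=
  (ind (path_end (cost z.1) k.+1 (V :\ w) w y) *
   (ind (nearest (cost z.2) V u w) * ind (t - W z.1 < cost z.2 u y)%R))%E.
have mh : measurable_fun setT h.
  apply: emeasurable_funM.
    apply: measurable_indb.
    apply: (measurableT_comp (measurable_path_end_inner mfL k.+1 y wV)).
    exact: measurable_fst.
  apply: emeasurable_funM; apply: measurable_indb.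
    apply: (measurableT_comp (measurable_nearest_star mfL uV wV)).
    exact: measurable_snd.
  apply: measurable_fun_ltr.
    apply: measurable_funB; first exact: measurable_cst.
    apply: (measurableT_comp (measurable_path_length_inner mfL k.+1 wV)).
    exact: measurable_fst.
  apply: (measurableT_comp (measurable_cost_star mfL uV yV)).
  exact: measurable_snd.
have h0 z : (0 <= h z)%E by rewrite !mule_ge0// indb_ge0.
have mhT : measurable_fun [set: T] (fun x => h (x, x)).
  rewrite /h /=; apply: emeasurable_funM; first exact/measurable_indb/mE.
  apply: emeasurable_funM; apply: measurable_indb;
    first exact: measurable_nearest_cost.
  apply: measurable_fun_ltr; last exact: measurable_cost.
  by apply: measurable_funB => //; exact: measurable_cst.
apply: (@le_trans _ _ (\int[P]_x h (x, x))%E); last first.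
  apply: ge0_le_integral => //.
  - by apply: emeasurable_funM => //; exact: measurable_indb.
  - move=> x _; rewrite /h [(x, x).1]/= [(x, x).2]/=.
    have [pe|_] := boolP (path_end (cost x) k.+1 (V :\ w) w y);
      last by rewrite !mul0e.
    have [nw|_] := boolP (nearest (cost x) V u w);
      last by rewrite !mul0e !mule0.
    rewrite /indb !mul1e lee_fin ler_nat (path_lengthS _ wV nw) -/(W x).
    have [tW|//] := ltP (t - W x) (cost x u y).
    have := last_edge_ge yV (etrans (path_endS k.+1 y wV nw) pe).
    have := cost_ge0 L x u w; move=> c0 le; rewrite ltrBlDr in tW.
    rewrite (lt_le_trans tW)//.
    by move: le c0; move: (last_edge _ _ _ _) (cost x u y) (cost x u w) (W x)
      => a b c e; lra.
rewrite (decouple_cost mfL JK mh h0) muleC.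
rewrite -ge0_integralZl//; last 2 first.
- by apply: emeasurable_funM => //; exact: measurable_indb.
- by move=> x _; rewrite mule_ge0 ?indb_ge0 ?ptail_ge0.
apply: ge0_le_integral => //.
- by move=> x _; rewrite !mule_ge0 ?indb_ge0 ?ptail_ge0.
- apply: measurable_funeM; apply: emeasurable_funM => //;
  exact: measurable_indb.
(* The function [h] again, now over the full sigma-algebra of [T], to obtain measurability of its
   partial integral in x. *)
- pose hT (z : T * T) : \bar R :=
    (ind (path_end (cost z.1) k.+1 (V :\ w) w y) *
     (ind (nearest (cost z.2) V u w) * ind (t - W z.1 < cost z.2 u y)%R))%E.
  have mhT2 : measurable_fun setT hT.
    apply: emeasurable_funM.
      by apply: measurable_indb; apply: (measurableT_comp (mE y));
        exact: measurable_fst.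
    apply: emeasurable_funM; apply: measurable_indb.
      apply: (measurableT_comp (measurable_nearest_cost V u w)).
      exact: measurable_snd.
    apply: measurable_fun_ltr; last first.
      by apply: (measurableT_comp (measurable_cost L u y));
        exact: measurable_snd.
    apply: measurable_funB; first exact: measurable_cst.
    by apply: (measurableT_comp mW); exact: measurable_fst.
  have hT0 z : (0 <= hT z)%E by rewrite !mule_ge0// indb_ge0.
  exact: (@measurable_fun_fubini_tonelli_F _ _ _ _ _ P _ mhT2 hT0).
- move=> x _; rewrite /h /= muleCA.
  have mn : measurable_fun [set: T] (fun z => ind (nearest (cost z) V u w) *
    ind (t - W x < cost z u y)%R)%E.
    apply: emeasurable_funM; apply: measurable_indb;
      first exact: measurable_nearest_cost.
    by apply: measurable_fun_ltr; [exact: measurable_cst|exact: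
      measurable_cost].
  rewrite (ge0_integralZl P measurableT mn _ (indb_ge0 _ _)); last first.
    by move=> z _; rewrite mule_ge0// indb_ge0.
  apply: lee_pmul => //; first exact: indb_ge0.
    by rewrite mule_ge0// ptail_ge0.
  exact: nearest_edge_ge.
Qed.

(** With at least two cities in V the path cannot end at its first stop w, so the closing edge is
    never the shortest edge at u. *)
Lemma last_edgeS k V u w x : w \in V -> nearest (cost x) V u w ->
  last_edge k.+2 V u x =
  \sum_(y in V :\ w) (path_end (cost x) k.+1 (V :\ w) w y)%:R * cost x u y.
Proof.
move=> wV nw; rewrite /last_edge (big_setD1 w)//= [X in X + _](_ : _ = 0).
  rewrite add0r; apply: eq_bigr => y _.
  by rewrite -[[exists _, _]]/(path_end (cost x) k.+2 V u y) (path_endS _ _ wV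
    nw).
rewrite -[[exists _, _]]/(path_end (cost x) k.+2 V u w) (path_endS _ _ wV nw).
case h: (path_end _ _ _ _ _); last by rewrite mul0r.
by have := path_end_in h; rewrite in_setD1 eqxx.
Qed.

(** Each of the k + 2 possible first neighbours contributes at most 1 / (k + 1) times the mean of
    [F], whichever city the path ends at. *)
Lemma last_edge_mean k V u : u \notin V -> #|V| = k.+2 ->
  (\int[P]_x (last_edge k.+2 V u x)%:E <= (k.+2%:R / k.+1%:R)%:E * pmean F)%E.
Proof.
move=> uV cV; have V0 : V != finset.set0 by rewrite -card_gt0 cV.
pose a : R := k.+1%:R^-1.
have a0 : 0 <= a by rewrite /a invr_ge0.
rewrite (integral_nearest mfL F_nonneg F_atomless uV V0); last 2 first.
- by apply/measurable_EFinP; exact: measurable_last_edge.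
- by move=> x; rewrite lee_fin last_edge_ge0.
have -> : ((k.+2%:R / k.+1%:R)%:E * pmean F = \sum_(w in V) (a%:E * pmean F))%E.
  rewrite -ge0_sume_distrl; last by move=> w _; rewrite lee_fin.
  by rewrite sumEFin sumr_const cV mulr_natl.
apply: lee_sum => w wV.
have JK : [disjoint inner V & star u V]%B.
  by rewrite disjoint_sym; exact: disjoint_star_inner.
have mE y : measurable_fun [set: T] (fun x => path_end (cost x) k.+1 (V :\ w) w
  y).
  exact: measurable_path_end_cost.
have mnc y : measurable_fun [set: T] (fun x => ind (nearest (cost x) V u w) *
  (cost x u y)%:E)%E.
  apply: emeasurable_funM; first exact/measurable_indb/measurable_nearest_cost.
  by apply/measurable_EFinP; exact: measurable_cost.
have nc0 y x : (0 <= ind (nearest (cost x) V u w) * (cost x u y)%:E)%E.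
  by rewrite mule_ge0 ?indb_ge0// lee_fin cost_ge0.
apply: (@le_trans _ _ (\int[P]_x \sum_(y <- enum (V :\ w))
    (ind (path_end (cost x) k.+1 (V :\ w) w y) *
     (ind (nearest (cost x) V u w) * (cost x u y)%:E)))%E).
  rewrite le_eqVlt; apply/orP; left; apply/eqP; apply: eq_integral => x _.
  rewrite big_enum/=; have [nw|_] := boolP (nearest (cost x) V u w); last first.
    by rewrite mul0e big1// => y _; rewrite mul0e mule0.
  rewrite mul1e (last_edgeS _ wV nw) -sumEFin; apply: eq_bigr => y _.
  by rewrite mul1e EFinM.
rewrite ge0_integral_sum//; last 2 first.
- by move=> y; apply: emeasurable_funM => //; exact/measurable_indb/mE.
- by move=> y x _; rewrite mule_ge0// indb_ge0.
have one : (\sum_(y in V :\ w) \int[P]_x ind (path_end (cost x) k.+1 (V :\ w) w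
  y) = 1)%E.
  have mE_ y : y \in V :\ w -> measurable_fun [set: T]
      (fun x => path_end (cost x) k.+1 (V :\ w) w y) by [].
  have m1 : measurable_fun [set: T] (fun=> 1%E : \bar R) by exact:
    measurable_cst.
  have h01 (x : T) : (0 <= 1 :> \bar R)%E by [].
  transitivity (\int[P]_x (1 : \bar R))%E.
    rewrite (integral_partition mE_ m1 h01 (ae_path_end wV cV)).
    by apply: eq_bigr => y _; apply: eq_integral => x _; rewrite mule1.
  by rewrite integral_cst//= probability_setT mule1.
rewrite big_enum/= -[leRHS]mul1e -one ge0_sume_distrl; last first.
  by move=> y _; apply: integral_ge0 => x _; exact: indb_ge0.
apply: lee_sum => y; rewrite in_setD1 => /andP[yw yV].
have wy : w != y by rewrite eq_sym.
rewrite (decouple_mul mfL JK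
  (f := fun x => ind (path_end (cost x) k.+1 (V :\ w) w y))
  (g := fun x => ind (nearest (cost x) V u w) * (cost x u y)%:E)%E).
- apply: lee_pmul => //.
  + by apply: integral_ge0 => x _; exact: indb_ge0.
  + exact: integral_ge0.
  + by have := nearest_edge_mean uV wV yV wy; rewrite cV.
- by apply: measurable_indb; exact: (measurable_path_end_inner mfL).
- apply: emeasurable_funM; first by apply: measurable_indb;
  exact: (measurable_nearest_star mfL).
  by apply/measurable_EFinP; exact: (measurable_cost_star mfL uV yV).
- by move=> x; exact: indb_ge0.
- by move=> x; exact: nc0.
Qed.

End tour_distribution.

(** * Law and mean of the tour length *)

Section tour_law.
Context (R : realType) d (T : measurableType d) (P : probability T R) (n : nat).
Context (L : 'I_n.+2 -> 'I_n.+2 -> {RV P >-> R}) (F : probability R R).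
Hypothesis mfL : mean_field_distances L F.
Hypothesis F_nonneg : F [set t | t < 0] = 0%E.
Hypothesis F_atomless : forall x, F [set x] = 0%E.
Hypothesis F_mean : (pmean F < +oo)%E.
Variables (v : T -> nat -> 'I_n.+2) (X : {RV P >-> R}).
Hypothesis v_nn : forall w, is_nn_tour (fun i j => L i j w) (v w).
Hypothesis X_length : forall w, X w = tour_length (fun i j => L i j w) (v w).

Local Notation others := ([set~ ord0]%SET : {set 'I_n.+2}).
Local Notation ind := (@indb R).

Definition greedy_tour (x : T) : R :=
  path_length (cost L x) n.+1 others ord0 + last_edge L n.+1 others ord0 x.

Lemma card_others : #|others| = n.+1.
Proof. by rewrite cardsC1 card_ord. Qed.

Let ord0_others : ord0 \notin others.
Proof. by rewrite !inE eqxx. Qed.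

Lemma measurable_greedy_tour : measurable_fun [set: T] greedy_tour.
Proof.
apply: measurable_funD; first exact: measurable_path_length_cost.
exact: measurable_last_edge.
Qed.

Lemma greedy_tour_ge0 x : 0 <= greedy_tour x.
Proof.
apply: addr_ge0; last exact: last_edge_ge0.
by apply: path_length_ge0 => i j; exact: cost_ge0.
Qed.

Lemma ae_greedy_tour : {ae P, forall x, X x = greedy_tour x}.
Proof.
apply: filterS (ae_nondegenerate mfL F_nonneg F_atomless) => x [tf Lc].
rewrite X_length (nn_tour_lengthE (c := cost L x) _ _ _ tf (v_nn x))//.
- by move=> i j ij; rewrite Lc.
- by move=> i j; exact: (costC mfL).
Qed.

Let mX : measurable_fun [set: T] X. Proof. exact: measurable_funPT. Qed.

Lemma ptail_tour t : (ptail (distribution P X) t = \int[P]_x ind (t <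
  greedy_tour x)%R)%E.
Proof.
transitivity (\int[P]_x ind (t < pospart (X x))%R)%E.
  rewrite integral_natr_bool//; apply: measurable_fun_ltr;
    first exact: measurable_cst.
  by apply: measurableT_comp => //; exact: measurable_pospart.
apply: ge0_ae_eq_integral => //.
- apply: measurable_indb; apply: measurable_fun_ltr;
  first exact: measurable_cst.
  by apply: measurableT_comp => //; exact: measurable_pospart.
- apply: measurable_indb; apply: measurable_fun_ltr;
  first exact: measurable_cst.
  exact: measurable_greedy_tour.
- by move=> x _; exact: indb_ge0.
- by move=> x _; exact: indb_ge0.
- apply: filterS ae_greedy_tour => x Xx _.
  by rewrite Xx pospart_id// greedy_tour_ge0.
Qed.

Lemma expectation_tour : ('E_P[X] = pmean (distribution P X))%E.
Proof.
rewrite unlock /pmean ge0_integral_distribution//; last 2 first.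
- by apply/measurable_EFinP; exact: measurable_pospart.
- by move=> y; rewrite lee_fin pospart_ge0.
apply: ae_eq_integral => //.
- exact/measurable_EFinP.
- by apply/measurable_EFinP; apply: measurableT_comp => //;
  exact: measurable_pospart.
- apply: filterS ae_greedy_tour => x Xx _ /=.
  by rewrite Xx pospart_id// greedy_tour_ge0.
Qed.

Lemma pmean_tour : (pmean (distribution P X) =
  pmean (pathlaw F n.+1) + \int[P]_x (last_edge L n.+1 others ord0 x)%:E)%E.
Proof.
transitivity (\int[P]_x (greedy_tour x)%:E)%E.
  rewrite -expectation_tour unlock; apply: ae_eq_integral => //.
  - exact/measurable_EFinP.
  - by apply/measurable_EFinP; exact: measurable_greedy_tour.
  - by apply: filterS ae_greedy_tour => x Xx _; rewrite Xx.
have mpl := measurable_path_length_cost L n.+1 others ord0.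
have pl0 x : 0 <= path_length (cost L x) n.+1 others ord0.
  by apply: path_length_ge0 => i j; exact: cost_ge0.
rewrite /greedy_tour; under eq_integral do rewrite EFinD.
rewrite ge0_integralD//; last 4 first.
- by move=> x _; rewrite lee_fin.
- exact/measurable_EFinP.
- by move=> x _; rewrite lee_fin last_edge_ge0.
- by apply/measurable_EFinP; exact: measurable_last_edge.
congr (_ + _)%E.
have mp : measurable_fun [set: R] (fun s : R => (pospart s)%:E).
  by apply/measurable_EFinP; exact: measurable_pospart.
transitivity (\int[P]_x (pospart (path_length (cost L x) n.+1 others
  ord0))%:E)%E.
  by apply: eq_integral => x _; rewrite pospart_id.
rewrite (integral_law (m := pathlaw F n.+1) (phi := fun s => (pospart s)%:E)
  mpl pl0)//.
- by apply: eq_integral => s _; rewrite pospart_id// pospart_ge0.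
- by move=> t; apply: path_length_law => //; exact: card_others.
- by move=> s; rewrite lee_fin pospart_ge0.
Qed.

(** The closing edge is crudely bounded by the sum of all edges at [ord0], which covers the instance
    with two cities as well; [last_edge_mean] starts at three. *)
Lemma last_edge_lty : (\int[P]_x (last_edge L n.+1 others ord0 x)%:E < +oo)%E.
Proof.
have mc y : measurable_fun [set: T] (fun x => (cost L x ord0 y)%:E).
  by apply/measurable_EFinP; exact: measurable_cost.
apply: (@le_lt_trans _ _ (\int[P]_x \sum_(y <- enum others) (cost L x ord0
  y)%:E)%E).
  apply: ge0_le_integral => //.
  - by move=> x _; rewrite lee_fin last_edge_ge0.
  - by apply/measurable_EFinP; exact: measurable_last_edge.
  - exact: emeasurable_sum.
  - move=> x _; rewrite sumEFin lee_fin big_enum/=; apply: ler_sum => y _.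
    by rewrite ler_piMl ?cost_ge0// lern1 leq_b1.
rewrite ge0_integral_sum//; last by move=> y x _; rewrite lee_fin cost_ge0.
rewrite big_enum/=; apply: lte_sum_pinfty => y.
rewrite in_setC1 eq_sym => y0.
have mp : measurable_fun [set: R] (fun s : R => (pospart s)%:E).
  by apply/measurable_EFinP; exact: measurable_pospart.
have p0 (s : R) : (0 <= (pospart s)%:E)%E by rewrite lee_fin pospart_ge0.
rewrite (_ : \int[P]_x _ = \int[P]_x (pospart (cost L x ord0 y))%:E)%E;
  last first.
  by apply: eq_integral => x _; rewrite pospart_id// cost_ge0.
rewrite (integral_cost mfL y0 mp p0); apply: le_lt_trans F_mean.
rewrite le_eqVlt; apply/orP; left; apply/eqP; apply: eq_integral => s _.
by rewrite pospart_id// pospart_ge0.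
Qed.

Lemma expectation_bounded_tour (g : R -> R) : continuous g -> bounded_fun g ->
  ('E_P[g \o X] = \int[distribution P X]_y (g (pospart y))%:E)%E.
Proof.
move=> cg bg; have mg : measurable_fun [set: R] g by exact:
  continuous_measurable_fun.
have [b Hb] : exists b : R, forall x, `|g x| <= b.
  move: bg => [K [_ HK]]; exists (K + 1) => x; apply: (HK (K + 1)) => //.
  by rewrite ltrDl.
have mgp : measurable_fun [set: R] (fun y => (g (pospart y))%:E).
  apply/measurable_EFinP; apply: measurableT_comp => //;
    exact: measurable_pospart.
rewrite unlock integral_distribution//; last first.
  apply: (@le_integrable _ _ _ _ _ _ _ (fun=> b%:E)) => //.
  - exact: measurableT_comp.
  - by move=> w _ /=; rewrite lee_fin (le_trans (Hb _))// ler_norm.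
  - apply/integrableP; split; first exact: measurable_cst.
    by rewrite integral_cst//= probability_setT mule1 ltry.
apply: ae_eq_integral => //.
- by apply/measurable_EFinP; apply: measurableT_comp.
- exact: measurableT_comp.
- apply: filterS ae_greedy_tour => x Xx _ /=.
  by rewrite Xx pospart_id// greedy_tour_ge0.
Qed.

End tour_law.

(* The n-th instance has n.+2 cities, so that every tour has at least two. *)
Theorem theorem2p4 (R : realType)
  (F : probability R R) (f : R -> R) (alpha C : R)
  (F_nonneg : F [set t | t < 0] = 0%E)
  (F_mean : F.-integrable [set: R] (fun t : R => t%:E))
  (F_variance : ('V_F[(fun t : R => t)] < +oo)%E)
  (F_density : has_density F f)
  (alpha_gtN1 : -1 < alpha) (alpha_lt0 : alpha < 0)
  (C_gt0 : 0 < C)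
  (f_near0 : f t / t `^ alpha @[t --> 0^'+] --> C)
  (d : nat -> measure_display)
  (Omega : forall n : nat, measurableType (d n))
  (P : forall n : nat, probability (Omega n) R)
  (L : forall n : nat, 'I_n.+2 -> 'I_n.+2 -> {RV (P n) >-> R})
  (L_mean_field : forall n : nat, mean_field_distances (L n) F)
  (v : forall n : nat, Omega n -> nat -> 'I_n.+2)
  (v_nn : forall (n : nat) (w : Omega n),
    is_nn_tour (fun i j => L n i j w) (v n w))
  (T : forall n : nat, {RV (P n) >-> R})
  (T_length : forall (n : nat) (w : Omega n),
    T n w = tour_length (fun i j => L n i j w) (v n w)) :
  [/\ forall n : nat, ('E_(P n)[T n])%E \is a fin_num,
      cvg (fine ('E_(P n)[T n])%E @[n --> \oo])
    & exists (d' : measure_display) (Omega' : measurableType d')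
        (Q : probability Omega' R) (Z : {RV Q >-> R}),
        cvg_in_distribution T Z].
Proof.
have Fatom := density_atomless F_density.
have Fmean := pmean_lty F_mean.
have Ffin : pmean F \is a fin_num by rewrite ge0_fin_numE ?pmean_ge0.
have [M HM] := pathlaw_mean_bounded F_mean F_density alpha_lt0 C_gt0 f_near0.
have pfin k : pmean (pathlaw F k) \is a fin_num.
  by rewrite ge0_fin_numE ?pmean_ge0// (le_lt_trans (HM k))// ltry.
pose p k := fine (pmean (pathlaw F k)).
have pE k : pmean (pathlaw F k) = (p k)%:E by rewrite fineK.
have p_cvg : cvgn p.
  apply: nondecreasing_is_cvgn.
    apply/nondecreasing_seqP => k; rewrite fine_le// [leRHS]pmean_addp leeDl//.
    exact: pmean_ge0.
  by exists M => _ [k _ <-]; rewrite -lee_fin -pE.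
pose law n := distribution (P n) (T n).
have lawE n : 'E_(P n)[T n]%E = pmean (law n).
  exact: (expectation_tour (L_mean_field n) F_nonneg Fatom (v_nn n) (T_length
    n)).
have law_mean n := pmean_tour (L_mean_field n) F_nonneg Fatom (v_nn n)
  (T_length n).
have lawfin n : pmean (law n) \is a fin_num.
  rewrite /law law_mean fin_numD pfin/= ge0_fin_numE.
    exact: last_edge_lty (L_mean_field n) Fmean.
  by apply: integral_ge0 => x _; rewrite lee_fin last_edge_ge0.
(* The instance with two cities is skipped: [law k.+1] belongs to k + 3 cities, so k + 2 of them
   differ from the start, as [tour_tail] requires. The shift is undone at the end by
   [cvg_shiftS]. *)
pose m k := tourlaw F k.+1.
pose t k : probability R R := law k.+1.
(* The difference is the mean of the first step, discarded in [tour_tail]; the quotient is the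
   excess over the mean of [F] left by the factor (k + 2) / (k + 1) of [last_edge_mean]. *)
pose e k := p k.+2 - p k.+1 + fine (pmean F) / k.+1%:R.
have mE k : (pmean (m k) = (p k.+1)%:E + pmean F)%E by rewrite /m /tourlaw
  pmean_addp pE.
have m_nd k x : (ptail (m k) x <= ptail (m k.+1) x)%E by exact:
  ptail_tourlaw_nd.
have m_bd k : (pmean (m k) <= (M + fine (pmean F))%:E)%E.
  by rewrite mE -{1}(fineK Ffin) -EFinD lee_fin lerD2r -lee_fin -pE.
have mt k x : (ptail (m k) x <= ptail (t k) x)%E.
  rewrite /t /law (ptail_tour (L_mean_field k.+1) F_nonneg Fatom (v_nn k.+1)
    (T_length k.+1)).
  apply: tour_tail => //; first by rewrite !inE eqxx.
  exact: card_others.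
have tm k : (pmean (t k) <= pmean (m k) + (e k)%:E)%E.
  rewrite /t /law law_mean pE mE.
  apply: (le_trans (leeD2l _ (last_edge_mean (L_mean_field k.+1) F_nonneg Fatom
    _ _))).
  - by rewrite !inE eqxx.
  - exact: card_others.
  - rewrite -(fineK Ffin) -EFinM -!EFinD lee_fin /e -[k.+2%:R]natr1.
    have k0 : k.+1%:R != 0 :> R by rewrite pnatr_eq0.
    rewrite mulrDl mul1r divff// le_eqVlt; apply/orP; left; apply/eqP; ring.
have e0 : e k @[k --> \oo] --> 0.
  have p1 : p k.+1 @[k --> \oo] --> limn p by rewrite (cvg_shiftS p).
  have p2 : p k.+2 @[k --> \oo] --> limn p by rewrite (cvg_shiftS (fun k => p
    k.+1)).
  rewrite -[0](addr0 0); apply: cvgD.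
    by rewrite -[0](subrr (limn p)); exact: cvgB.
  rewrite -[0](mulr0 (fine (pmean F))); apply: cvgM; first exact: cvg_cst.
  exact: cvg_harmonic.
split.
- by move=> n; rewrite lawE.
- have /cvg_ex[l tl] := pmean_dominated_cvg m_nd m_bd mt tm e0.
  apply/cvg_ex; exists l; rewrite -(cvg_shiftS (fun n => fine 'E_(P n)[T n]%E)).
  rewrite (_ : (fun n => _) = (fun k => fine (pmean (t k))))//.
  by apply/funext => k; rewrite lawE.
- have [Z HZ] := dominated_weak_limit m_nd m_bd mt tm e0.
  exists _, (measurableTypeR R), (unif01 R), Z => g cg bg.
  rewrite -(cvg_shiftS (fun n => 'E_(P n)[g \o T n]%E)).
  have -> : ('E_(unif01 R)[g \o Z] = \int[unif01 R]_v (g (Z v))%:E)%E by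
    rewrite unlock.
  rewrite (_ : (fun n => _) = (fun k => \int[t k]_x (g (pospart x))%:E)%E);
    first exact: HZ.
  apply/funext => k.
  exact: (expectation_bounded_tour (L_mean_field k.+1) F_nonneg Fatom (v_nn
    k.+1)
    (T_length k.+1) cg bg).
Qed.
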